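(* Let $L$ be the bounded Jacobi matrix with parameters $a_{2n-1}=3$, $a_{2n}=1$ for $n=1,2,\dots$, $b_1=\beta_1$, and $b_k=\beta_n$ whenever $2n^2\le k<2(n+1)^2$ ($n=1,2,\dots$), where $(\beta_j)_{j\ge1}$ is the dyadic enumeration sequence described in the context. Let $d\mu$ be the spectral measure of $L$ and $p_n$ its orthonormal polynomials. Then: (1) $\mathrm{supp}(d\mu)=[-5,-1]\cup[1,5]$. (2) For each $n\ge 1$ there is an $x_n$ with $|x_n-\beta_n|\le 2\cdot 3^{-2n}$ such that $p_{2(n+1)^2-1}(x_n)=0$. Consequently, the set $\{x\in(-1,1) : p_n(x)=0 \text{ for some } n\}$ is dense in $[-1,1]$.
   Context: A Jacobi matrix with parameters $a_n>0$, $b_n\in\mathbb{R}$ ($n\ge1$) is the semi-infinite symmetric tridiagonal matrix on $\ell^2(\{1,2,\dots\})$ with diagonal entries $L_{nn}=b_n$ and off-diagonal entries $L_{n,n+1}=L_{n+1,n}=a_n$. Its spectral measure $d\mu$ is the probability measure on $\mathbb{R}$ associated with the vector $(1,0,0,\dots)$; its orthonormal polynomials $p_n$ (degree $n$, positive leading coefficient, $\int p_np_m\,d\mu=\delta_{nm}$) satisfy $xp_n(x)=a_{n+1}p_{n+1}(x)+b_{n+1}p_n(x)+a_np_{n-1}(x)$ for $n\ge0$ (last term absent when $n=0$). The sequence $(\beta_j)_{j\ge 1}$ is $0,\,-\tfrac12,0,\tfrac12,\,-\tfrac34,-\tfrac12,-\tfrac14,0,\tfrac14,\tfrac12,\tfrac34,\,-\tfrac78,\dots$: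 it is the concatenation, for $k=0,1,2,3,\dots$, of the finite blocks $\big(j/2^k\big)_{j=-(2^k-1),\,\dots,\,2^k-1}$ listed in increasing order, so that it goes through all dyadic rationals in $(-1,1)$ with denominator $2^k$ successively, each value being repeated multiple times. *)

(* Defs.v *)
From mathcomp Require Import all_boot all_order all_algebra.
From mathcomp Require Import all_classical all_reals all_analysis.
Set Implicit Arguments.
Unset Strict Implicit.
Unset Printing Implicit Defensive.
Import Order.TTheory GRing.Theory Num.Theory.
Import numFieldNormedType.Exports.
Local Open Scope classical_set_scope.
Local Open Scope ring_scope.

(* A vector of l^2({1,2,...}) is a function u : nat -> R whose value u i is the
   coordinate of index i + 1.  Real scalars suffice: the matrices below have
   real entries, so their spectral projections are real. *)

Definition ell2 (R : realType) (u : nat -> R) : Prop :=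
  cvgn (series (fun i => u i ^+ 2)).

Definition dot (R : realType) (u v : nat -> R) : R :=
  limn (series (fun i => u i * v i)).

Definition delta1 (R : realType) : nat -> R := fun i => (i == 0)%:R.

(* The parameters keep their indices n >= 1 (a 0 and b 0 are never used), so
   row i + 1 of the matrix has entries a i, b i.+1, a i.+1. *)
Definition jacobi (R : realType) (a b : nat -> R) (u : nat -> R) : nat -> R :=
  fun i => (if i is j.+1 then a j.+1 * u j else 0)
           + b i.+1 * u i + a i.+1 * u i.+1.

(* E A is an operator on l^2; its values outside l^2 are irrelevant.  The last
   field says that A |-> <u, E A u> is a countably additive measure. *)
Record projection_valued_measure (R : realType)
    (E : set (measurableTypeR R) -> (nat -> R) -> (nat -> R)) : Prop := {
  pvm_ell2 : forall A u, measurable A -> ell2 u -> ell2 (E A u) ;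
  pvm_linear : forall A (c : R) u v, measurable A -> ell2 u -> ell2 v ->
    E A (fun i => c * u i + v i) = (fun i => c * E A u i + E A v i) ;
  pvm_symmetric : forall A u v, measurable A -> ell2 u -> ell2 v ->
    dot (E A u) v = dot u (E A v) ;
  pvm_setI : forall A B u, measurable A -> measurable B -> ell2 u ->
    E (A `&` B) u = E A (E B u) ;
  pvm_setT : forall u, ell2 u -> E setT u = u ;
  pvm_measure : forall u, ell2 u ->
    exists nu : {measure set (measurableTypeR R) -> \bar R},
      forall A, measurable A -> nu A = (dot u (E A u))%:E }.

(* T = \int x dE(x), as an identity of quadratic forms; this determines the
   operator since the T considered here are symmetric. *)
Definition spectral_resolution (R : realType)
    (T : (nat -> R) -> (nat -> R))
    (E : set (measurableTypeR R) -> (nat -> R) -> (nat -> R)) : Prop :=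
  projection_valued_measure E /\
  forall u, ell2 u ->
  forall nu : {measure set (measurableTypeR R) -> \bar R},
    (forall A, measurable A -> nu A = (dot u (E A u))%:E) ->
    nu.-integrable setT (fun x : measurableTypeR R => (x : R)%:E) /\
    (\int[nu]_x (x : R)%:E = (dot u (T u))%:E)%E.

Definition spectral_measure (R : realType)
    (T : (nat -> R) -> (nat -> R)) (v : nat -> R)
    (mu : probability (measurableTypeR R) R) : Prop :=
  exists2 E, spectral_resolution T E &
    forall A, measurable A -> mu A = (dot v (E A v))%:E.

Definition orthonormal_polynomials (R : realType)
    (mu : probability (measurableTypeR R) R) (p : nat -> {poly R}) : Prop :=
  (forall n, size (p n) = n.+1 /\ 0 < lead_coef (p n)) /\
  (forall n m, (\int[mu]_x ((p n).[x] * (p m).[x])%:E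
                  = ((n == m)%:R : R)%:E)%E).

Definition supp (R : realType) (mu : probability (measurableTypeR R) R) :
    set R :=
  [set x | forall U : set R, open U -> U x -> (0 < mu U)%E].

(* The numbers j / 2^k for j = -(2^k - 1), ..., 2^k - 1, with j = i + 1 - 2^k. *)
Definition dyadic_block (R : unitRingType) (k : nat) : seq R :=
  mkseq (fun i => (i.+1%:R - 2 ^+ k) / 2 ^+ k) (2 ^ k.+1 - 1).

(* beta R j is meant for j >= 1.  Blocks are nonempty, so the first j of them
   already contain the j-th term of the infinite concatenation. *)
Definition beta (R : unitRingType) (j : nat) : R :=
  nth 0 (flatten (mkseq (@dyadic_block R) j)) j.-1.

(* Main.v *)
Require Import Defs.
From mathcomp Require Import all_boot all_order all_algebra.
From mathcomp Require Import all_classical all_reals all_analysis.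
From mathcomp Require Import measurable_realfun spectral sesquilinear complex.
From mathcomp Require Import ring lra zify.
Set Implicit Arguments.
Unset Strict Implicit.
Unset Printing Implicit Defensive.
Import Order.TTheory GRing.Theory Num.Theory.
Import numFieldNormedType.Exports.
Local Open Scope classical_set_scope.
Local Open Scope ring_scope.

(* Write T for the Jacobi operator. Pairing the coordinates 2k, 2k+1 gives
   T = 3 S + C + B with S an isometry, C a contraction and B
   diagonal with entries in [-1, 1]. Hence |<u, T u>| <= 5 |u|^2, and
   <S u, T u> >= |u|^2 keeps the spectrum away from (-1, 1).

   Conversely the n-th block is a piece of length 4n + 2 of the operator of
   period two shifted by beta_n. Its bounded generalized eigenfunctions of
   energy y, 2 < |y| < 4, cut off to that block, are approximate eigenvectors
   of T at beta_n + y. As every subinterval of (-1, 1) contains beta_n for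
   arbitrarily large n, these energies fill the two bands.

   For the zeros: cutting the real line into short intervals shows that
   <e_m, E(A) e_n> is the integral over A of q_m q_n, where q solves the
   three-term recurrence, so p_n is a multiple of q_n and its zeros are the
   eigenvalues of the truncated matrix. On the last block the truncation at
   the odd index N = 2(n+1)^2 - 1 carries the edge state
   u_(N-2j) = (-1/3)^j, 0 <= j <= 2n, an eigenvector for beta_n up to an error
   of size 3^(-2n), and the spectral theorem for symmetric matrices gives an
   eigenvalue at that distance of beta_n. *)

(** * The space l^2 *)

Section Ell2.
Variable R : realType.
Implicit Types (u v w : nat -> R) (c : R).

Lemma cvg_series_ge0 (f : nat -> R) (M : R) :
  (forall i, 0 <= f i) -> (forall n, \sum_(0 <= i < n) f i <= M) ->
  cvgn (series f).
Proof.
move=> f0 fM; apply: nondecreasing_is_cvgn.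
  by apply/nondecreasing_seqP => n; rewrite !seriesEnat/= big_nat_recr//= lerDl.
by exists M => _ [n _ <-]; rewrite seriesEnat; exact: fM.
Qed.

Lemma ell2_bound u M : (forall n, \sum_(0 <= i < n) u i ^+ 2 <= M) -> ell2 u.
Proof. by move=> uM; apply: cvg_series_ge0 uM => i; exact: sqr_ge0. Qed.

Lemma series_le_lim (f : nat -> R) n : (forall i, 0 <= f i) ->
  cvgn (series f) -> \sum_(0 <= i < n) f i <= limn (series f).
Proof.
move=> f0 cf; rewrite -[leLHS]/(series f n); apply: nondecreasing_cvgn_le cf n.
by apply/nondecreasing_seqP => n; rewrite !seriesEnat/= big_nat_recr//= lerDl.
Qed.

Lemma dotuuE u : dot u u = limn (series (fun i => u i ^+ 2)).
Proof. by congr (limn (series _)); apply/funext => i; rewrite expr2. Qed.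

Lemma sum_le_dot u n : ell2 u -> \sum_(0 <= i < n) u i ^+ 2 <= dot u u.
Proof. by move=> lu; rewrite dotuuE; apply: series_le_lim => // i; exact: sqr_ge0. Qed.

Lemma dot_ge0 u : ell2 u -> 0 <= dot u u.
Proof. by move=> lu; have := sum_le_dot 0 lu; rewrite big_nil. Qed.

Lemma dot_eq0 u : ell2 u -> dot u u = 0 -> u = 0.
Proof.
move=> lu u0; apply/funext => n; apply/eqP; rewrite -sqrf_eq0 eq_le sqr_ge0 andbT.
rewrite -u0; apply: le_trans (sum_le_dot n.+1 lu).
by rewrite big_nat_recr//= lerDr sumr_ge0// => i _; exact: sqr_ge0.
Qed.

Lemma dot_cvg u v : ell2 u -> ell2 v -> cvgn (series (fun i => u i * v i)).
Proof.
move=> lu lv; apply: normed_cvg.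
apply: (@cvg_series_ge0 _ (dot u u + dot v v)) => [i|n]; first exact: normr_ge0.
apply: le_trans (lerD (sum_le_dot n lu) (sum_le_dot n lv)).
rewrite -big_split/=; apply: ler_sum => i _.
by rewrite ler_norml; apply/andP; split; nra.
Qed.

Lemma ell2D u v : ell2 u -> ell2 v -> ell2 (u + v).
Proof.
move=> lu lv; apply: (@ell2_bound _ (2 * dot u u + 2 * dot v v)) => n.
apply: (@le_trans _ _ (2 * \sum_(0 <= i < n) u i ^+ 2
                       + 2 * \sum_(0 <= i < n) v i ^+ 2)).
  rewrite !mulr_sumr -big_split/=; apply: ler_sum => i _.
  rewrite -subr_ge0 (_ : _ - _ = (u i - v i) ^+ 2) ?sqr_ge0//.
  by rewrite addrfctE; ring.
by apply: lerD; apply: ler_wpM2l => //; exact: sum_le_dot.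
Qed.

Lemma ell2_bounded c u v : 0 <= c -> (forall i, `|v i| <= c * `|u i|) ->
  ell2 u -> ell2 v.
Proof.
move=> c0 vu lu; apply: (@ell2_bound _ (c ^+ 2 * dot u u)) => n.
apply: (@le_trans _ _ (c ^+ 2 * \sum_(0 <= i < n) u i ^+ 2)).
  rewrite mulr_sumr; apply: ler_sum => i _.
  rewrite -(real_normK (num_real (v i))) -(real_normK (num_real (u i))) -exprMn.
  by rewrite ler_pXn2r// nnegrE ?mulr_ge0.
by apply: ler_wpM2l; [exact: sqr_ge0|exact: sum_le_dot].
Qed.

Lemma ell2Z c u : ell2 u -> ell2 (c *: u).
Proof.
move=> lu; apply: (ell2_bounded (c := `|c|)) lu => // i.
by rewrite -normrM.
Qed.

Lemma ell2N u : ell2 u -> ell2 (- u).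
Proof. by move=> lu; rewrite -scaleN1r; exact: ell2Z. Qed.

Lemma ell2B u v : ell2 u -> ell2 v -> ell2 (u - v).
Proof. by move=> lu lv; apply: ell2D => //; exact: ell2N. Qed.

Lemma dotC u v : dot u v = dot v u.
Proof. by congr (limn (series _)); apply/funext => i; rewrite mulrC. Qed.

Lemma dotDl u v w : ell2 u -> ell2 v -> ell2 w ->
  dot (u + v) w = dot u w + dot v w.
Proof.
move=> lu lv lw; rewrite /dot -lim_seriesD; try exact: dot_cvg.
by congr (limn (series _)); apply/funext => i; rewrite -mulrDl.
Qed.

Lemma dotZl c u w : ell2 u -> ell2 w -> dot (c *: u) w = c * dot u w.
Proof.
move=> lu lw; rewrite /dot -[c * _]lim_seriesZ; last exact: dot_cvg.
by congr (limn (series _)); apply/funext => i; rewrite -[RHS]/(c * (u i * w i)) mulrA.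
Qed.

Lemma dotDr u v w : ell2 u -> ell2 v -> ell2 w ->
  dot w (u + v) = dot w u + dot w v.
Proof. by move=> lu lv lw; rewrite !(dotC w) dotDl. Qed.

Lemma dotZr c u w : ell2 u -> ell2 w -> dot w (c *: u) = c * dot w u.
Proof. by move=> lu lw; rewrite !(dotC w) dotZl. Qed.

Lemma dotNl u w : ell2 u -> ell2 w -> dot (- u) w = - dot u w.
Proof. by move=> lu lw; rewrite -scaleN1r dotZl// mulN1r. Qed.

Lemma dotNr u w : ell2 u -> ell2 w -> dot w (- u) = - dot w u.
Proof. by move=> lu lw; rewrite -scaleN1r dotZr// mulN1r. Qed.

Lemma dotBl u v w : ell2 u -> ell2 v -> ell2 w ->
  dot (u - v) w = dot u w - dot v w.
Proof. by move=> lu lv lw; rewrite dotDl ?dotNl//; exact: ell2N. Qed.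

Lemma dotBr u v w : ell2 u -> ell2 v -> ell2 w ->
  dot w (u - v) = dot w u - dot w v.
Proof. by move=> lu lv lw; rewrite !(dotC w) dotBl. Qed.

Lemma dotDD u v : ell2 u -> ell2 v ->
  dot (u + v) (u + v) = dot u u + 2 * dot u v + dot v v.
Proof.
move=> lu lv; have luv := ell2D lu lv.
rewrite (dotDl lu lv luv) (dotDr lu lv lu) (dotDr lu lv lv) (dotC v u).
by rewrite mulr_natl mulr2n !addrA.
Qed.

Lemma dotBB u v : ell2 u -> ell2 v ->
  dot (u - v) (u - v) = dot u u - 2 * dot u v + dot v v.
Proof.
move=> lu lv; have lNv := ell2N lv.
rewrite (dotDD lu lNv) (dotNr lv lu) (dotNr lv lNv) (dotNl lv lv).
by rewrite opprK mulrN.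
Qed.

(** Expand the squares of [u + v] and [u - v]. It stands in for Cauchy-Schwarz throughout and loses
    nothing when both vectors have the same norm. *)
Lemma dot_amgm u v : ell2 u -> ell2 v -> 2 * `|dot u v| <= dot u u + dot v v.
Proof.
move=> lu lv; have := dot_ge0 (ell2D lu lv); have := dot_ge0 (ell2B lu lv).
rewrite (dotDD lu lv) (dotBB lu lv) => h1 h2.
have [h|h] := leP 0 (dot u v); [rewrite ger0_norm|rewrite ltr0_norm]; lra.
Qed.

Lemma sum_tail0 (f : nat -> R) N n : (forall i, (N <= i)%N -> f i = 0) ->
  (N <= n)%N -> \sum_(0 <= i < n) f i = \sum_(0 <= i < N) f i.
Proof.
move=> fN Nn; rewrite (big_cat_nat (leq0n N) Nn)/= [X in _ + X]big_nat_cond.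
by rewrite [X in _ + X]big1 ?addr0// => i /andP[/andP[Ni _] _]; exact: fN.
Qed.

Lemma ell2_fin u N : (forall i, (N <= i)%N -> u i = 0) -> ell2 u.
Proof.
move=> uN; apply: (@ell2_bound _ (\sum_(0 <= i < N) u i ^+ 2)) => n.
have [nN|Nn] := leqP n N.
  by rewrite (big_cat_nat (leq0n n) nN)//= lerDl sumr_ge0// => i _; exact: sqr_ge0.
by rewrite (sum_tail0 (N := N)) ?(ltnW Nn)// => i Ni; rewrite uN// expr0n.
Qed.

Lemma dot_fin u v N : (forall i, (N <= i)%N -> u i = 0) ->
  dot u v = \sum_(0 <= i < N) u i * v i.
Proof.
move=> uN; rewrite /dot; apply: lim_near_cst => //; exists N => // n /= Nn.
by rewrite seriesEnat/= (sum_tail0 (N := N))// => i Ni; rewrite uN// mul0r.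
Qed.

Lemma ell2_0 : ell2 (0 : nat -> R).
Proof. exact: (@ell2_fin _ 0). Qed.

Lemma dot0r u : dot u 0 = 0.
Proof. by rewrite dotC (@dot_fin _ _ 0)// big_nil. Qed.

Definition basis_vec (n : nat) : nat -> R := fun i => (i == n)%:R.

Lemma basis_vec_supp n i : (n.+1 <= i)%N -> basis_vec n i = 0.
Proof. by move=> ni; rewrite /basis_vec gtn_eqF. Qed.

Lemma ell2_basis n : ell2 (basis_vec n).
Proof. exact: (ell2_fin (@basis_vec_supp n)). Qed.

Lemma dot_basis n v : dot (basis_vec n) v = v n.
Proof.
rewrite (dot_fin _ (@basis_vec_supp n)) big_nat_recr//= big_nat_cond big1 ?add0r.
  by rewrite /basis_vec eqxx mul1r.
by move=> i /andP[/andP[_ iN] _]; rewrite /basis_vec ltn_eqF// mul0r.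
Qed.

Lemma fin_sum_basis u N : (forall i, (N <= i)%N -> u i = 0) ->
  u = \sum_(0 <= n < N) u n *: basis_vec n.
Proof.
move=> uN; apply/funext => i; rewrite fct_sumE.
have [Ni|iN] := leqP N i.
  rewrite uN// big_nat_cond big1// => n /andP[/andP[_ nN] _].
  by rewrite -[LHS]/(u n * (i == n)%:R) gtn_eqF ?mulr0//; exact: leq_trans Ni.
rewrite big_mkord (bigD1 (Ordinal iN))//= big1 ?addr0.
  by rewrite -[RHS]/(u i * (i == i)%:R) eqxx mulr1.
move=> j ji; rewrite -[LHS]/(u j * (i == j)%:R).
by rewrite [(i == j)]negbTE ?mulr0// eq_sym; apply: contra ji => /eqP h; apply/eqP/val_inj.
Qed.

Definition shiftr u : nat -> R := fun i => if i is j.+1 then u j else 0.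
Definition shiftl u : nat -> R := fun i => u i.+1.
(** The isometry S: it exchanges the two coordinates of each pair 2k, 2k+1. *)
Definition swap u : nat -> R := fun i => u (if odd i then i.-1 else i.+1).

Lemma sum_swap (f : nat -> R) n :
  \sum_(0 <= i < n.*2) f (if odd i then i.-1 else i.+1) = \sum_(0 <= i < n.*2) f i.
Proof.
elim: n => [|n IH]; first by rewrite !big_nil.
rewrite doubleS !big_nat_recr//= IH odd_double/= -!addrA; congr (_ + _).
by rewrite addrC.
Qed.

Lemma ell2_swap u : ell2 u -> ell2 (swap u).
Proof.
move=> lu; apply: (@ell2_bound _ (dot u u)) => n.
apply: le_trans (sum_le_dot n.*2 lu); rewrite -[leRHS](sum_swap (fun i => u i ^+ 2)).
have nn : (n <= n.*2)%N by rewrite -addnn leq_addr.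
by rewrite (big_cat_nat (leq0n n) nn)//= lerDl sumr_ge0// => i _; exact: sqr_ge0.
Qed.

(** The partial sums of the two series agree at even lengths, so the limits agree along that
    subsequence. *)
Lemma dot_swap u v : ell2 u -> ell2 v -> dot (swap u) (swap v) = dot u v.
Proof.
move=> lu lv.
have e : (series (fun i => swap u i * swap v i)) \o double
       = (series (fun i => u i * v i)) \o double.
  apply/funext => n; rewrite /= !seriesEnat/=.
  by rewrite -(sum_swap (fun i => u i * v i)).
have dbl : (fun n : nat => n.*2) @ \oo --> \oo.
  by apply/cvgnyPge => M; exists M => // n /= Mn; apply: leq_trans Mn _; rewrite -addnn leq_addr.
have c1 := cvg_comp _ _ dbl (dot_cvg (ell2_swap lu) (ell2_swap lv)).
have c2 := cvg_comp _ _ dbl (dot_cvg lu lv).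
move: c1; rewrite e => c1; exact: cvg_unique c1 c2.
Qed.

Lemma ell2_shiftr u : ell2 u -> ell2 (shiftr u).
Proof.
move=> lu; apply: (@ell2_bound _ (dot u u)) => -[|n].
  by rewrite big_nil dot_ge0.
by rewrite big_nat_recl//= expr0n add0r; exact: sum_le_dot.
Qed.

Lemma ell2_shiftl u : ell2 u -> ell2 (shiftl u).
Proof.
move=> lu; apply: (@ell2_bound _ (dot u u)) => n.
apply: le_trans (sum_le_dot n.+1 lu).
by rewrite [leRHS]big_nat_recl//= lerDr sqr_ge0.
Qed.

Lemma dot_shiftr u v : ell2 u -> ell2 v -> dot (shiftr u) v = dot u (shiftl v).
Proof.
move=> lu lv.
have c1 : series (fun i => shiftr u i * v i) @ \oo --> dot (shiftr u) v.
  exact: dot_cvg (ell2_shiftr lu) lv.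
have c2 : series (fun i => u i * shiftl v i) @ \oo --> dot u (shiftl v).
  exact: dot_cvg lu (ell2_shiftl lv).
have e : (fun n => series (fun i => shiftr u i * v i) n.+1)
       = series (fun i => u i * shiftl v i).
  by apply/funext => n; rewrite !seriesEnat/= big_nat_recl//= mul0r add0r.
have c3 := c1; rewrite -cvg_shiftS e in c3.
exact: cvg_unique c3 c2.
Qed.

Lemma dot_shiftr2 u : ell2 u -> dot (shiftr u) (shiftr u) = dot u u.
Proof. by move=> lu; rewrite dot_shiftr//; exact: ell2_shiftr. Qed.

Lemma dot_shiftl_le u : ell2 u -> dot (shiftl u) (shiftl u) <= dot u u.
Proof.
move=> lu; rewrite [leLHS]dotuuE; apply: limr_le; first exact: ell2_shiftl.
near=> n; rewrite seriesEnat/=; apply: le_trans (sum_le_dot n.+1 lu).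
by rewrite [leRHS]big_nat_recl//= lerDr sqr_ge0.
Unshelve. all: by end_near. Qed.

Lemma dot_le_bounded c u v : 0 <= c -> (forall i, `|v i| <= c * `|u i|) ->
  ell2 u -> dot v v <= c ^+ 2 * dot u u.
Proof.
move=> c0 vu lu; rewrite [leLHS]dotuuE; apply: limr_le.
  exact: ell2_bounded vu lu.
near=> n; rewrite seriesEnat/=.
apply: (@le_trans _ _ (c ^+ 2 * \sum_(0 <= i < n) u i ^+ 2)).
  rewrite mulr_sumr; apply: ler_sum => i _.
  rewrite -(real_normK (num_real (v i))) -(real_normK (num_real (u i))) -exprMn.
  by rewrite ler_pXn2r// nnegrE ?mulr_ge0.
by apply: ler_wpM2l; [exact: sqr_ge0|exact: sum_le_dot].
Unshelve. all: by end_near. Qed.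

End Ell2.

(** * Spectral resolutions of a symmetric operator *)

Section SpectralResolution.
Variables (R : realType) (T : (nat -> R) -> (nat -> R)).
Variable E : set (measurableTypeR R) -> (nat -> R) -> (nat -> R).
Hypothesis T_ell2 : forall u, ell2 u -> ell2 (T u).
Hypothesis T_lin : forall (c : R) u v, T (c *: u + v) = c *: T u + T v.
Hypothesis T_sym : forall u v, ell2 u -> ell2 v -> dot (T u) v = dot u (T v).
Hypothesis E_res : spectral_resolution T E.
Implicit Types (u v w : nat -> R) (A B C : set (measurableTypeR R)).

Let E_pvm : projection_valued_measure E := E_res.1.

Lemma opD u v : T (u + v) = T u + T v.
Proof. by rewrite -[u]scale1r T_lin !scale1r. Qed.

Lemma opZ c u : T (c *: u) = c *: T u.
Proof.
have T0 : T 0 = 0.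
  by apply: (@addrI _ (T 0)); rewrite -opD !addr0.
by rewrite -[c *: u]addr0 T_lin T0 addr0.
Qed.

Lemma proj_ell2 A u : measurable A -> ell2 u -> ell2 (E A u).
Proof. exact: (pvm_ell2 E_pvm). Qed.

Lemma proj_lin A c u v : measurable A -> ell2 u -> ell2 v ->
  E A (c *: u + v) = c *: E A u + E A v.
Proof. exact: (pvm_linear E_pvm). Qed.

Lemma projD A u v : measurable A -> ell2 u -> ell2 v ->
  E A (u + v) = E A u + E A v.
Proof. by move=> mA lu lv; rewrite -{1}[u]scale1r proj_lin// scale1r. Qed.

Lemma proj0 A : measurable A -> E A 0 = 0.
Proof.
move=> mA; apply: (@addrI _ (E A 0)).
by rewrite -(projD mA (@ell2_0 R) (@ell2_0 R)) !addr0.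
Qed.

Lemma projZ A c u : measurable A -> ell2 u -> E A (c *: u) = c *: E A u.
Proof.
move=> mA lu; rewrite -[c *: u]addr0 (proj_lin _ mA lu (@ell2_0 R)).
by rewrite proj0// addr0.
Qed.

Lemma proj_sym A u v : measurable A -> ell2 u -> ell2 v ->
  dot (E A u) v = dot u (E A v).
Proof. exact: (pvm_symmetric E_pvm). Qed.

Lemma proj_setI A B u : measurable A -> measurable B -> ell2 u ->
  E (A `&` B) u = E A (E B u).
Proof. exact: (pvm_setI E_pvm). Qed.

Lemma proj_setT u : ell2 u -> E setT u = u.
Proof. exact: (pvm_setT E_pvm). Qed.

Lemma proj_idem A u : measurable A -> ell2 u -> E A (E A u) = E A u.
Proof. by move=> mA lu; rewrite -proj_setI// setIid. Qed.

Lemma dot_proj A u : measurable A -> ell2 u ->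
  dot u (E A u) = dot (E A u) (E A u).
Proof.
by move=> mA lu; rewrite (proj_sym mA lu (proj_ell2 mA lu)) proj_idem.
Qed.

Lemma proj_set0 u : ell2 u -> E set0 u = 0.
Proof.
move=> lu; apply: dot_eq0; first exact: proj_ell2.
rewrite -dot_proj//; have [nu nuE] := pvm_measure E_pvm lu.
by have := nuE set0 measurable0; rewrite measure0 => -[].
Qed.

Lemma proj_disj A B u v : measurable A -> measurable B -> A `&` B = set0 ->
  ell2 u -> ell2 v -> dot (E A u) (E B v) = 0.
Proof.
move=> mA mB AB lu lv; rewrite (proj_sym mA lu (proj_ell2 mB lv)) -proj_setI// AB proj_set0//.
exact: dot0r.
Qed.

(** Additivity is given only for the scalar measures <u, E A u>. Together with idempotence and
    orthogonality it determines all inner products of the three vectors, and the squared norm of the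
    difference comes out as 0. *)
Lemma proj_setU A B u : measurable A -> measurable B -> A `&` B = set0 ->
  ell2 u -> E (A `|` B) u = E A u + E B u.
Proof.
move=> mA mB AB lu; have mAB := measurableU _ _ mA mB.
pose w := E (A `|` B) u.
have lw : ell2 w := proj_ell2 mAB lu.
have lA := proj_ell2 mA lu; have lB := proj_ell2 mB lu.
have wA : E A w = E A u by rewrite /w -proj_setI// setIUr setIid AB setU0.
have wB : E B w = E B u by rewrite /w -proj_setI// setIUr setIid setIC AB set0U.
have ww : dot w w = dot (E A u) (E A u) + dot (E B u) (E B u).
  rewrite -!dot_proj//; have [nu nuE] := pvm_measure E_pvm lu.
  have : nu (A `|` B) = (nu A + nu B)%E by exact: measureU.
  rewrite !nuE//.
  by move=> -[].
have d1 : dot w (E A u) = dot (E A u) (E A u).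
  by rewrite -{1}(proj_idem mA lu) -(proj_sym mA lw lA) wA.
have d2 : dot w (E B u) = dot (E B u) (E B u).
  by rewrite -{1}(proj_idem mB lu) -(proj_sym mB lw lB) wB.
have d3 := proj_disj mA mB AB lu lu.
apply/eqP; rewrite -subr_eq0; apply/eqP; apply: dot_eq0.
  by apply: ell2B => //; exact: ell2D.
rewrite (dotBB lw (ell2D lA lB)) (dotDD lA lB) (dotDr lA lB lw) d1 d2 d3 -/w ww.
ring.
Qed.

Lemma proj_setC A u : measurable A -> ell2 u -> u = E A u + E (~` A) u.
Proof.
move=> mA lu; rewrite -proj_setU ?setICr ?setUv ?proj_setT//.
exact: measurableC.
Qed.

(* The spectral measure of [E A u + E B v] is the sum of those of [E A u] and
   [E B v]: compare first moments. *)
Lemma op_disj A B u v : measurable A -> measurable B -> A `&` B = set0 ->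
  ell2 u -> ell2 v -> dot (E A u) (T (E B v)) = 0.
Proof.
move=> mA mB AB lu lv.
set x := E A u; set y := E B v.
have lx : ell2 x := proj_ell2 mA lu; have ly : ell2 y := proj_ell2 mB lv.
have [nx nxE] := pvm_measure E_pvm lx; have [ny nyE] := pvm_measure E_pvm ly.
have [ix sx] := E_res.2 _ lx nx nxE; have [iy sy] := E_res.2 _ ly ny nyE.
have Cxy C : measurable C -> dot x (E C y) = 0.
  move=> mC; rewrite /y -proj_setI// proj_disj//; first exact: measurableI.
  by rewrite setICA AB setI0.
have [] := E_res.2 _ (ell2D lx ly) (measure_add nx ny).
  move=> C mC; transitivity (nx C + ny C)%E; first exact: measure_addE.
  rewrite nxE// nyE// -EFinD; congr EFin.
  have lCx := proj_ell2 mC lx; have lCy := proj_ell2 mC ly.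
  rewrite (projD mC lx ly) (dotDl lx ly (ell2D lCx lCy)) (dotDr lCx lCy lx).
  rewrite (dotDr lCx lCy ly) Cxy// -(proj_sym mC ly lx) (dotC _ x) Cxy//.
  by rewrite addr0 add0r.
move=> _; rewrite integral_measure_add// sx sy -EFinD => -[].
have lTx := T_ell2 lx; have lTy := T_ell2 ly.
rewrite opD (dotDl lx ly (ell2D lTx lTy)) (dotDr lTx lTy lx) (dotDr lTx lTy ly).
rewrite -(T_sym ly lx) (dotC _ x) => h.
lra.
Qed.

(** The measure attached to [E A u] does not charge the complement of [A], so its first moment may
    be computed over [A], where pointwise bounds on x are available. *)
Lemma dotT_bounds A u (nu : {measure set (measurableTypeR R) -> \bar R}) :
  measurable A -> ell2 u ->
  (forall C, measurable C -> nu C = (dot (E A u) (E C (E A u)))%:E) ->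
  [/\ nu A = (dot (E A u) (E A u))%:E, nu.-integrable A (EFin \o id) &
  (dot (E A u) (T (E A u)))%:E = (\int[nu]_(x in A) (x : R)%:E)%E].
Proof.
move=> mA lu nuE; have lw := proj_ell2 mA lu.
have [iw sw] := E_res.2 _ lw nu nuE.
have nA : nu (~` A) = 0%E.
  rewrite nuE ?dot_proj//; try exact: measurableC.
  rewrite -proj_setI//; last exact: measurableC.
  by rewrite setICl proj_set0// dot0r.
split.
- by rewrite nuE// proj_idem.
- exact: integrableS iw.
rewrite -sw (negligible_integral (measurableC mA) measurableT iw nA).
by rewrite setTD setCK.
Qed.

Lemma dotT_ge A u l : measurable A -> ell2 u -> (forall x, A x -> l <= x) ->
  l * dot (E A u) (E A u) <= dot (E A u) (T (E A u)).
Proof.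
move=> mA lu Al; have lw := proj_ell2 mA lu.
have [nu nuE] := pvm_measure E_pvm lw.
have [nA iA sA] := dotT_bounds mA lu nuE.
rewrite -lee_fin sA EFinM -nA -integral_cst//; apply: le_integral => //.
  apply: (@measurable_bounded_integrable _ _ _ nu (cst l)) => //.
    by rewrite nA ltry.
  exact: bounded_cst.
by move=> x /set_mem Ax /=; rewrite lee_fin Al.
Qed.

Lemma dotT_le A u l : measurable A -> ell2 u -> (forall x, A x -> x <= l) ->
  dot (E A u) (T (E A u)) <= l * dot (E A u) (E A u).
Proof.
move=> mA lu Al; have lw := proj_ell2 mA lu.
have [nu nuE] := pvm_measure E_pvm lw.
have [nA iA sA] := dotT_bounds mA lu nuE.
rewrite -lee_fin sA EFinM -nA -integral_cst//; apply: le_integral => //.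
  apply: (@measurable_bounded_integrable _ _ _ nu (cst l)) => //.
    by rewrite nA ltry.
  exact: bounded_cst.
by move=> x /set_mem Ax /=; rewrite lee_fin Al.
Qed.

(** On the range of [E A] the form of T - c is at most h times the squared norm, by [dotT_ge] and
    [dotT_le]. Applied to u + v and u - v and subtracted, this polarizes to the bilinear form. *)
Lemma dotT_polar A u v c h : measurable A -> ell2 u -> ell2 v ->
  (forall x, A x -> c - h <= x <= c + h) ->
  2 * `|dot u (T (E A v)) - c * dot u (E A v)|
    <= h * (dot u (E A u) + dot v (E A v)).
Proof.
move=> mA lu lv Ah; rewrite !dot_proj//.
have mA' := measurableC mA.
have lAv := proj_ell2 mA lv; have lAu := proj_ell2 mA lu; have lAu' := proj_ell2 mA' lu.
have lTv := T_ell2 lAv; have lTu := T_ell2 lAu.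
have -> : dot u (T (E A v)) = dot (E A u) (T (E A v)).
  rewrite {1}(proj_setC mA lu) (dotDl lAu lAu' lTv) (op_disj mA' mA)// ?addr0//.
  by rewrite setICl.
rewrite -(proj_sym mA lu lv).
have -> : dot (E A u) v = dot (E A u) (E A v).
  by rewrite -(proj_sym mA lAu lv) proj_idem.
have Q w : ell2 w -> `|dot (E A w) (T (E A w)) - c * dot (E A w) (E A w)|
    <= h * dot (E A w) (E A w).
  move=> lw; rewrite ler_norml.
  have a1 : forall x, A x -> c - h <= x by move=> x /Ah/andP[].
  have a2 : forall x, A x -> x <= c + h by move=> x /Ah/andP[].
  have := dotT_ge mA lw a1; have := dotT_le mA lw a2.
  by rewrite mulrBl mulrDl => h1 h2; apply/andP; split; lra.
have := Q _ (ell2D lu lv); have := Q _ (ell2B lu lv).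
rewrite -[u - v]/(u + - v) (projD mA lu (ell2N lv)) -scaleN1r (projZ _ mA lv) scaleN1r.
rewrite (projD mA lu lv) opD -scaleN1r opD opZ !scaleN1r.
move: lAv lAu lTv lTu; move: (E A u) (E A v) => x y ly lx lTy lTx.
rewrite (dotDD lx ly) (dotBB lx ly).
rewrite (dotDl lx ly (ell2D lTx lTy)) (dotDr lTx lTy lx) (dotDr lTx lTy ly).
rewrite (dotBl lx ly (ell2B lTx lTy)) (dotBr lTx lTy lx) (dotBr lTx lTy ly).
rewrite -(T_sym ly lx) (dotC _ x).
rewrite !ler_norml; move=> /andP[h1 h2] /andP[h3 h4].
rewrite -ler_pdivlMl// ler_norml; apply/andP; split; lra.
Qed.

End SpectralResolution.

(** * Bounded operators: from spectral projections to integrals of polynomials *)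

Lemma horner_bounded (R : realType) (p : {poly R}) (M : R) :
  exists C : R, forall x, `|x| <= M -> `|p.[x]| <= C.
Proof.
elim/poly_ind: p => [|p c [C pC]].
  by exists 0 => x _; rewrite horner0 normr0.
exists (C * M + `|c|) => x xM; rewrite hornerMXaddC.
apply: le_trans (ler_normD _ _) _; rewrite lerD2r normrM.
by apply: ler_pM => //; exact: pC.
Qed.

Section BoundedResolution.
Variables (R : realType) (T : (nat -> R) -> (nat -> R)).
Variable E : set (measurableTypeR R) -> (nat -> R) -> (nat -> R).
Hypothesis T_ell2 : forall u, ell2 u -> ell2 (T u).
Hypothesis T_lin : forall (c : R) u v, T (c *: u + v) = c *: T u + T v.
Hypothesis T_sym : forall u v, ell2 u -> ell2 v -> dot (T u) v = dot u (T v).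
Hypothesis E_res : spectral_resolution T E.
Variable K : R.
Hypothesis T_bound : forall u, ell2 u -> `|dot u (T u)| <= K * dot u u.
Variables (mu : probability (measurableTypeR R) R) (e0 : nat -> R).
Hypothesis e0_ell2 : ell2 e0.
Hypothesis muE : forall A, measurable A -> mu A = (dot e0 (E A e0))%:E.
Implicit Types (u v w : nat -> R) (A B C : set (measurableTypeR R)).

(** On the range of [E A] the form of T is at least M, or at most -M, times the squared norm,
    against the bound K < M. *)
Lemma proj_out A u M : measurable A -> ell2 u -> K < M ->
  (forall x, A x -> M <= x) \/ (forall x, A x -> x <= - M) -> E A u = 0.
Proof.
move=> mA lu KM AM; have lw := proj_ell2 E_res mA lu.
apply: dot_eq0 => //; apply/eqP; rewrite eq_le dot_ge0// andbT.
have := T_bound lw; rewrite ler_norml => /andP[b1 b2].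
have d0 := dot_ge0 lw.
case: AM => AM.
  have := dotT_ge E_res mA lu AM; nra.
have := dotT_le E_res mA lu AM; nra.
Qed.

Definition window (M : R) : set (measurableTypeR R) := `[- M, M[%classic.

Lemma measurable_window M : measurable (window M).
Proof. exact: measurable_itv. Qed.

Lemma proj_window u M : ell2 u -> K < M -> E (window M) u = u.
Proof.
move=> lu KM; have mW := measurable_window M.
rewrite [RHS](proj_setC E_res mW lu).
(* The set difference keeps the two rays disjoint even if M is negative. *)
have -> : ~` window M = [set` `]-oo, - M[] `|` ([set` `[M, +oo[] `\` [set` `]-oo, - M[]).
  apply/seteqP; split => x; rewrite /window/= !in_itv/= ?andbT.
    move=> /negP; rewrite negb_and -ltNge -leNgt => /orP[|Mx]; first by left.
    by have [] := ltP x (- M); [left|right; split].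
  by move=> [|[]] h1; [|move=> _]; apply/negP; rewrite negb_and -ltNge -leNgt ?h1 ?orbT.
have mL : measurable ([set` `]-oo, - M[] : set (measurableTypeR R)) by exact: measurable_itv.
have mR : measurable ([set` `[M, +oo[] : set (measurableTypeR R)) by exact: measurable_itv.
rewrite (proj_setU E_res) //; last 2 first.
- exact: measurableD.
- by rewrite setDE setICA setICr setI0.
rewrite (proj_out (A := [set` `]-oo, - M[]) mL lu KM); last first.
  by right => x /=; rewrite in_itv/= => /ltW.
rewrite (proj_out (A := _ `\` _) (measurableD mR mL) lu KM) ?addr0//.
by left => x /= []; rewrite in_itv/= andbT.
Qed.

Lemma mu_window M : K < M -> mu (~` window M) = 0%E.
Proof.
move=> KM; have mW := measurable_window M.
rewrite muE; last exact: measurableC.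
congr EFin; rewrite -{2}(proj_window e0_ell2 KM) -(proj_setI E_res) //.
  by rewrite setICl (proj_set0 E_res)// dot0r.
exact: measurableC.
Qed.

(** [mu] lives on a bounded window, on which polynomials are bounded. *)
Lemma integrable_horner (p : {poly R}) A : measurable A ->
  mu.-integrable A (EFin \o (horner p : measurableTypeR R -> R)).
Proof.
move=> mA; apply: (@integrableS _ _ _ mu setT) => //.
have K1 : K < K + 1 by rewrite ltrDl.
have mW := measurable_window (K + 1).
have mp D : measurable_fun D (horner p : measurableTypeR R -> R).
  exact: measurable_poly.
apply/(negligible_integrable (measurableC mW) measurableT _ (mu_window K1)).
  exact/measurable_EFinP.
rewrite setTD setCK; apply: measurable_bounded_integrable => //.
  by rewrite (le_lt_trans (probability_le1 mu _)) ?ltry.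
have [C pC] := horner_bounded p (K + 1).
exists C; split; rewrite ?num_real// => B CB x; rewrite /window/= in_itv/= => /andP[x1 x2].
by apply: le_trans (ltW CB); apply: pC; rewrite ler_norml x1 ltW.
Qed.

Lemma integrable_horner_norm (p : {poly R}) A : measurable A ->
  mu.-integrable A (EFin \o (fun x : measurableTypeR R => `|p.[x]|)).
Proof. by move=> mA; exact: integrable_norm (integrable_horner p mA). Qed.

Lemma Rintegral_window (p : {poly R}) A M : measurable A -> K < M ->
  \int[mu]_(x in A) p.[x] = \int[mu]_(x in A `&` window M) p.[x].
Proof.
move=> mA KM; have mW := measurable_window M; rewrite /Rintegral; congr fine.
rewrite (negligible_integral (measurableC mW) mA (integrable_horner p mA) (mu_window KM)).
by rewrite setDE setCK.
Qed.

Section Step.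
Variables (u v : nat -> R) (g : {poly R}).
Hypotheses (lu : ell2 u) (lv : ell2 v).
Hypothesis uvg : forall A, measurable A ->
  dot u (E A v) = \int[mu]_(x in A) g.[x].

(* Both quantities are additive in A, and on a set of length 2h the defect is at
   most h/2 times the mass; the total mass being finite, the defect vanishes. *)
Let defect A := dot u (T (E A v)) - \int[mu]_(x in A) ('X * g).[x].
Let mass A := dot u (E A u) + dot v (E A v) + 2 * \int[mu]_(x in A) `|g.[x]|.

Lemma defectU A B : measurable A -> measurable B -> A `&` B = set0 ->
  defect (A `|` B) = defect A + defect B.
Proof.
move=> mA mB AB; rewrite /defect Rintegral_setU//; last 2 first.
- exact: integrable_horner (measurableU _ _ mA mB).
- by apply/disj_setPS; rewrite AB.
rewrite (proj_setU E_res)// (opD T_lin) dotDr //; try exact/T_ell2/(proj_ell2 E_res).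
ring.
Qed.

Lemma massU A B : measurable A -> measurable B -> A `&` B = set0 ->
  mass (A `|` B) = mass A + mass B.
Proof.
move=> mA mB AB; rewrite /mass Rintegral_setU//; last 2 first.
- exact: integrable_horner_norm (measurableU _ _ mA mB).
- by apply/disj_setPS; rewrite AB.
rewrite !(proj_setU E_res)// !dotDr //; try exact/(proj_ell2 E_res).
ring.
Qed.

(** On a short set T may be replaced by c in the form, by polarization, and x by c under the
    integral, each at a cost of order h. The two main terms then agree by [uvg]. *)
Lemma defect_local A c h : measurable A ->
  (forall x, A x -> c - h <= x <= c + h) -> 2 * `|defect A| <= h * mass A.
Proof.
move=> mA Ah.
have h1 := dotT_polar T_ell2 T_lin T_sym E_res mA lu lv Ah.
have h2 : `|\int[mu]_(x in A) (c%:P * g - 'X * g).[x]|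
    <= h * \int[mu]_(x in A) `|g.[x]|.
  apply: le_trans (le_normr_Rintegral mA (integrable_horner _ mA)) _.
  rewrite -RintegralZl//; last exact: integrable_horner_norm.
  apply: le_Rintegral => //.
  - exact: integrable_horner_norm.
  - rewrite (_ : _ \o _ = (fun x => h%:E * (`|g.[x]|)%:E)%E)//.
    by apply: integrableZl => //; exact: integrable_horner_norm.
  move=> x /Ah /andP[x1 x2]; rewrite -mulrBl hornerM normrM !hornerE.
  by apply: ler_wpM2r => //; rewrite ler_norml; apply/andP; split; lra.
have h3 : \int[mu]_(x in A) (c%:P * g - 'X * g).[x]
    = c * dot u (E A v) - \int[mu]_(x in A) ('X * g).[x].
  rewrite uvg// -RintegralZl//; last exact: integrable_horner.
  rewrite -RintegralB//; first by apply: eq_Rintegral => x _; rewrite !hornerE.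
    rewrite (_ : _ \o _ = EFin \o (horner (c%:P * g))).
      exact: integrable_horner.
    by apply/funext => x /=; rewrite hornerCM.
  exact: integrable_horner.
rewrite h3 in h2; rewrite /defect /mass.
have -> : dot u (T (E A v)) - \int[mu]_(x in A) ('X * g).[x]
  = (dot u (T (E A v)) - c * dot u (E A v))
    + (c * dot u (E A v) - \int[mu]_(x in A) ('X * g).[x]) by ring.
apply: le_trans (_ : 2 * (_ + _) <= _); first by rewrite ler_pM2l//; exact: ler_normD.
lra.
Qed.

(** Induction on the number of slices of length 2h: the defect is additive, so its absolute value is
    subadditive, and the mass is additive. Half-open intervals tile exactly. *)
Lemma defect_slices A M h n : measurable A -> 0 <= h ->
  2 * `|defect (A `&` [set` `[- M, - M + n%:R * (2 * h)[])|
    <= h * mass (A `&` [set` `[- M, - M + n%:R * (2 * h)[]).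
Proof.
move=> mA h0; elim: n => [|n IH].
  rewrite mul0r addr0 set_itvxx setI0; apply: (@defect_local _ 0) => //.
set I := [set` `[- M, - M + n%:R * (2 * h)[] in IH *.
set J : set (measurableTypeR R) :=
  [set` `[- M + n%:R * (2 * h), - M + n.+1%:R * (2 * h)[].
have mI : measurable (A `&` I) by apply: measurableI => //; exact: measurable_itv.
have mJ : measurable (A `&` J) by apply: measurableI => //; exact: measurable_itv.
have -> : A `&` [set` `[- M, - M + n.+1%:R * (2 * h)[] = (A `&` I) `|` (A `&` J).
  rewrite -setIUr; congr (_ `&` _).
  rewrite /I /J -itv_bndbnd_setU// bnd_simp.
    by rewrite lerDl mulr_ge0// mulr_ge0.
  by rewrite lerD2l ler_wpM2r// ?mulr_ge0// ler_nat.
have dIJ : (A `&` I) `&` (A `&` J) = set0.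
  apply/seteqP; split => // x; rewrite /I /J => -[[_ /=]]; rewrite in_itv/= => /andP[_ x1] [_ /=].
  by rewrite in_itv/= leNgt x1.
rewrite defectU// massU// mulrDr.
apply: le_trans (_ : 2 * (_ + _) <= _); first by rewrite ler_pM2l//; exact: ler_normD.
rewrite mulrDr; apply: lerD => //.
apply: (@defect_local _ (- M + n%:R * (2 * h) + h)) => //.
move=> x; rewrite /J => -[_ /=]; rewrite in_itv/= -addn1 natrD => /andP[x1 x2].
by apply/andP; split; lra.
Qed.

(** Applying T to the vector multiplies the density by X. This replaces a functional calculus: only
    scalar densities are propagated. *)
Lemma dot_proj_op A : measurable A ->
  dot u (E A (T v)) = \int[mu]_(x in A) ('X * g).[x].
Proof.
move=> mA.
pose M := `|K| + 1; have KM : K < M by rewrite /M ltr_pwDr// ler_norm.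
have M0 : 0 < M by rewrite /M ltr_wpDl.
have mW := measurable_window M.
have lAu := proj_ell2 E_res mA lu; have lAv := proj_ell2 E_res mA lv.
have mA' := measurableC mA.
have lA'u := proj_ell2 E_res mA' lu; have lA'v := proj_ell2 E_res mA' lv.
have lTAv := T_ell2 lAv.
(* T commutes with [E A] in this pairing, as both off-diagonal terms vanish by [op_disj]. *)
have -> : dot u (E A (T v)) = dot u (T (E A v)).
  rewrite -(proj_sym E_res mA lu (T_ell2 lv)).
  rewrite {1}(proj_setC E_res mA lv) (opD T_lin) (dotDr lTAv (T_ell2 lA'v) lAu).
  rewrite (op_disj T_ell2 T_lin T_sym E_res mA mA')// ?setICr// addr0.
  rewrite {2}(proj_setC E_res mA lu) (dotDl lAu lA'u lTAv).
  by rewrite (op_disj T_ell2 T_lin T_sym E_res mA' mA)// ?setICl// addr0.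
apply/eqP; rewrite -subr_eq0 -normr_le0.
have -> : dot u (T (E A v)) - \int[mu]_(x in A) ('X * g).[x]
    = defect (A `&` window M).
  by rewrite /defect (proj_setI E_res)// (proj_window lv KM) -Rintegral_window.
set D := `|_|; set G := mass (A `&` window M).
(* The window has length 2M and is cut into n + 1 slices of half-length M / (n + 1). *)
have DG n : 2 * D <= M / n.+1%:R * G.
  have M0n : 0 <= M / n.+1%:R by rewrite divr_ge0// ltW.
  have := defect_slices M n.+1 mA M0n.
  rewrite (_ : - M + _ = M)//.
  have n0 : n.+1%:R != 0 :> R by rewrite pnatr_eq0.
  by field.
rewrite leNgt; apply/negP => D0.
have G0 : 0 < G.
  have := lt_le_trans D0 (le_trans (_ : D <= 2 * D) (DG 0)).
  by rewrite divr1 pmulr_rgt0//; apply; lra.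
have [n /= nP] : exists n : nat, M * G / D < n.+1%:R.
  exists (Num.truncn (M * G / D)); exact: truncnS_gt.
have := DG n; rewrite mulrAC ler_pdivlMr// leNgt => /negP; apply.
move: nP; rewrite ltr_pdivrMr// => nP; nra.
Qed.
End Step.

End BoundedResolution.

(** * Orthogonal polynomials of a Jacobi operator *)

Section Orthonormal.
Variables (R : realType) (L : {poly R} -> R).
Hypothesis L_lin : forall c f g, L (c *: f + g) = c * L f + L g.
Implicit Types (p q : nat -> {poly R}) (f g : {poly R}).

Definition orthonormal_family q :=
  (forall n, size (q n) = n.+1) /\ forall n m, L (q n * q m) = (n == m)%:R.

Lemma functional0 : L 0 = 0.
Proof. by have := L_lin (-1) 0 0; rewrite scaler0 addr0 mulN1r addNr. Qed.

Lemma functional_mulDl c f g h : L ((c *: f + g) * h) = c * L (f * h) + L (g * h).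
Proof. by rewrite mulrDl -scalerAl L_lin. Qed.

Lemma functional_mulDr c f g h : L (h * (c *: f + g)) = c * L (h * f) + L (h * g).
Proof. by rewrite ![h * _]mulrC functional_mulDl. Qed.

Lemma family_reduce q k f : (forall n, size (q n) = n.+1) -> (size f <= k.+1)%N ->
  exists c g, f = c *: q k + g /\ (size g <= k)%N.
Proof.
move=> sq sf; exists (f`_k / lead_coef (q k)), (f - (f`_k / lead_coef (q k)) *: q k).
split; first by rewrite addrC subrK.
have lq : lead_coef (q k) != 0 by rewrite lead_coef_eq0 -size_poly_eq0 sq.
apply/leq_sizeP => j; rewrite leq_eqVlt => /predU1P[<-|kj].
  rewrite coefB coefZ [X in _ / X * _]lead_coefE sq/= mulfVK ?subrr//.
  by rewrite lead_coefE sq in lq.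
have fj : f`_j = 0 by rewrite nth_default// (leq_trans sf).
have qj : (q k)`_j = 0 by rewrite nth_default// sq.
by rewrite coefB coefZ fj qj mulr0 subr0.
Qed.

Lemma family_ortho_lt q n k f : orthonormal_family q -> (size f <= k)%N ->
  (k <= n)%N -> L (f * q n) = 0.
Proof.
move=> [sq oq]; elim: k f => [|k IH] f.
  by rewrite leqn0 size_poly_eq0 => /eqP-> _; rewrite mul0r functional0.
move=> sf kn; have [c [g [-> sg]]] := family_reduce sq sf.
by rewrite functional_mulDl (IH g) ?(ltnW kn)// oq ltn_eqF// mulr0 addr0.
Qed.

(** Positivity comes from the family itself: in its coordinates [L (f * f)] is a sum of squares. *)
Lemma family_definite q k f : orthonormal_family q -> (size f <= k)%N ->
  0 <= L (f * f) /\ (L (f * f) = 0 -> f = 0).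
Proof.
move=> oq; elim: k f => [|k IH] f.
  by rewrite leqn0 size_poly_eq0 => /eqP->; rewrite mul0r functional0.
move=> sf; have [c [g [-> sg]]] := family_reduce oq.1 sf.
have [g0 g1] := IH g sg.
have gq : L (g * q k) = 0 by exact: family_ortho_lt sg _.
have -> : L ((c *: q k + g) * (c *: q k + g)) = c ^+ 2 + L (g * g).
  by rewrite functional_mulDl !functional_mulDr gq [q k * g]mulrC gq oq.2 eqxx mulr1 mulr0 addr0 add0r expr2.
split=> [|cg0]; first by rewrite addr_ge0// sqr_ge0.
have c0 : c = 0.
  by apply/eqP; rewrite -sqrf_eq0 eq_le sqr_ge0 andbT; lra.
by rewrite c0 scale0r add0r; apply: g1; move: cg0; rewrite c0 expr0n add0r.
Qed.

(** Write p n = c q n + r with r of lower degree. As r is orthogonal to both [p n] and [q n],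
    [L (r * r)] vanishes and definiteness gives r = 0. *)
Lemma family_unique p q n : orthonormal_family p -> orthonormal_family q ->
  exists2 c, c != 0 & p n = c *: q n.
Proof.
move=> op oq; have [c [r [pE sr]]] := family_reduce oq.1 (eq_leq (op.1 n)).
exists c.
  apply/eqP => c0; move: pE; rewrite c0 scale0r add0r => pE.
  by move: sr; rewrite -pE op.1 ltnn.
suff r0 : r = 0 by rewrite pE r0 addr0.
apply: (family_definite oq sr).2.
have h1 := family_ortho_lt op sr (leqnn n).
have h2 := family_ortho_lt oq sr (leqnn n).
by move: h1; rewrite pE functional_mulDr h2 mulr0 add0r.
Qed.

End Orthonormal.

Section JacobiPolynomials.
Variables (R : realType) (a b : nat -> R).

(** Carries the polynomials of index n and n + 1 together, which makes the three-term recurrence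
    structural. *)
Fixpoint jacobi_poly_pair (n : nat) : {poly R} * {poly R} :=
  if n is m.+1 then
    let: (r, s) := jacobi_poly_pair m in
    (s, (a m.+2)^-1 *: (('X - (b m.+2)%:P) * s - a m.+1 *: r))
  else (1, (a 1)^-1 *: ('X - (b 1)%:P)).

Definition jacobi_poly n := (jacobi_poly_pair n).1.

Lemma jacobi_poly0 : jacobi_poly 0 = 1. Proof. by []. Qed.

Lemma jacobi_poly1 : jacobi_poly 1 = (a 1)^-1 *: ('X - (b 1)%:P).
Proof. by []. Qed.

Lemma jacobi_polySS n : jacobi_poly n.+2 =
  (a n.+2)^-1 *: (('X - (b n.+2)%:P) * jacobi_poly n.+1 - a n.+1 *: jacobi_poly n).
Proof. by rewrite /jacobi_poly /=; case: (jacobi_poly_pair n). Qed.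

Hypothesis a_neq0 : forall n, a n.+1 != 0.

Lemma size_jacobi_poly n : size (jacobi_poly n) = n.+1.
Proof.
suff H : size (jacobi_poly n) = n.+1 /\ size (jacobi_poly n.+1) = n.+2 by case: H.
elim: n => [|n [IH1 IH2]].
  by rewrite jacobi_poly0 jacobi_poly1 size_poly1 size_scale ?invr_neq0// size_XsubC.
split => //; rewrite jacobi_polySS size_scale ?invr_neq0//.
have s1 : size (('X - (b n.+2)%:P) * jacobi_poly n.+1) = n.+3.
  by rewrite size_monicM ?monicXsubC ?size_XsubC ?IH2// -size_poly_eq0 IH2.
by rewrite size_polyDl s1// size_polyN (leq_ltn_trans (size_scale_leq _ _))// IH1.
Qed.

End JacobiPolynomials.

(** * Jacobi operators and the densities of their spectral projections *)

Section JacobiOperator.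
Variables (R : realType) (a b : nat -> R) (K : R).

Let addE (u v : nat -> R) i : (u + v) i = u i + v i :> R. Proof. by []. Qed.
Let scaleE c (u : nat -> R) i : (c *: u) i = c * u i :> R. Proof. by []. Qed.

Hypothesis K_ge0 : 0 <= K.
Hypothesis aK : forall i, `|a i.+1| <= K.
Hypothesis bK : forall i, `|b i.+1| <= K.
Implicit Types u v : nat -> R.

Definition diag_op (d : nat -> R) u : nat -> R := fun i => d i.+1 * u i.

Lemma ell2_diag (d : nat -> R) u : (forall i, `|d i.+1| <= K) -> ell2 u ->
  ell2 (diag_op d u).
Proof.
move=> dK lu; apply: (ell2_bounded K_ge0 _ lu) => i.
by rewrite normrM ler_wpM2r.
Qed.

Lemma dot_diag (d : nat -> R) u v : dot (diag_op d u) v = dot u (diag_op d v).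
Proof.
by congr (limn (series _)); apply/funext => i; rewrite mulrCA mulrA.
Qed.

Lemma jacobiE u : jacobi a b u =
  shiftr (diag_op a u) + diag_op b u + diag_op a (shiftl u).
Proof. by apply/funext => -[|i]. Qed.

Lemma jacobi_at0 u : jacobi a b u 0 = b 1 * u 0%N + a 1 * u 1%N.
Proof. by rewrite /jacobi add0r. Qed.

Lemma jacobi_atS u i : jacobi a b u i.+1 =
  a i.+1 * u i + b i.+2 * u i.+1 + a i.+2 * u i.+2.
Proof. by []. Qed.

Lemma jacobi_linear c u v : jacobi a b (c *: u + v) = c *: jacobi a b u + jacobi a b v.
Proof.
by apply/funext => -[|i]; rewrite !(addE, scaleE, jacobi_at0, jacobi_atS); ring.
Qed.

Lemma ell2_jacobi u : ell2 u -> ell2 (jacobi a b u).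
Proof.
move=> lu; rewrite jacobiE; apply: ell2D; first apply: ell2D.
- exact/ell2_shiftr/ell2_diag.
- exact: ell2_diag.
- exact/ell2_diag/ell2_shiftl.
Qed.

Lemma jacobi_sym u v : ell2 u -> ell2 v ->
  dot (jacobi a b u) v = dot u (jacobi a b v).
Proof.
move=> lu lv; rewrite !jacobiE.
have l1 := ell2_diag aK lu; have l2 := ell2_diag aK lv.
have l3 := ell2_diag bK lu; have l4 := ell2_diag bK lv.
have l5 := ell2_shiftl lu; have l6 := ell2_shiftl lv.
have l7 := ell2_diag aK l5; have l8 := ell2_diag aK l6.
have l9 := ell2_shiftr l1; have l10 := ell2_shiftr l2.
rewrite (dotDl (ell2D l9 l3) l7 lv) (dotDl l9 l3 lv).
rewrite (dotDr (ell2D l10 l4) l8 lu) (dotDr l10 l4 lu).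
rewrite (dot_shiftr l1 lv) (dot_diag a) (dot_diag b) (dot_diag a (shiftl u)).
rewrite (dotC u (shiftr _)) (dot_shiftr l2 lu) (dotC (diag_op a v)).
by rewrite -addrA addrC [X in X + _]addrC.
Qed.

Lemma jacobi_basis0 : jacobi a b (basis_vec R 0) =
  b 1 *: basis_vec R 0 + a 1 *: basis_vec R 1.
Proof.
by apply/funext => -[|i]; rewrite !(addE, scaleE, jacobi_at0, jacobi_atS)
  /basis_vec ?eqSS; [|case: i => [|i]]; rewrite ?mulr0 ?mulr1 ?addr0 ?add0r.
Qed.

Lemma jacobi_basisS n : jacobi a b (basis_vec R n.+1) =
  a n.+1 *: basis_vec R n + b n.+2 *: basis_vec R n.+1 + a n.+2 *: basis_vec R n.+2.
Proof.
apply/funext => -[|i]; rewrite !(addE, scaleE, jacobi_at0, jacobi_atS) /basis_vec ?eqSS.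
  by case: n => [|n]; rewrite ?mulr0 ?mulr1 ?addr0 ?add0r.
have nS k : (k == k.+1) = false by rewrite ltn_eqF.
have Sn k : (k.+1 == k) = false by rewrite gtn_eqF.
have SSn k : (k.+2 == k) = false by rewrite gtn_eqF// ltnW.
have [->|in0] := eqVneq i n; first by rewrite nS Sn !mulr0 !add0r !addr0.
have [->|in1] := eqVneq i n.+1; first by rewrite SSn !mulr0 !add0r !addr0.
by have [->|in2] := eqVneq i.+1 n; rewrite ?mulr0 ?mulr1 ?addr0 ?add0r.
Qed.

Variable E : set (measurableTypeR R) -> (nat -> R) -> (nat -> R).
Hypothesis E_res : spectral_resolution (jacobi a b) E.
Variable M : R.
Hypothesis T_bound : forall u, ell2 u -> `|dot u (jacobi a b u)| <= M * dot u u.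
Variable mu : probability (measurableTypeR R) R.
Hypothesis muE : forall A, measurable A ->
  mu A = (dot (@delta1 R) (E A (@delta1 R)))%:E.
Hypothesis a_neq0 : forall n, a n.+1 != 0.

Lemma ell2_delta1 : ell2 (@delta1 R).
Proof. exact: ell2_basis 0. Qed.

Let int_horner := integrable_horner E_res T_bound ell2_delta1 muE.

Lemma Rintegral_lin (A : set (measurableTypeR R)) c (f g : {poly R}) : measurable A ->
  \int[mu]_(x in A) (c *: f + g).[x]
   = c * \int[mu]_(x in A) f.[x] + \int[mu]_(x in A) g.[x].
Proof.
move=> mA; rewrite -RintegralZl//; last exact: int_horner.
rewrite -RintegralD//; first by apply: eq_Rintegral => x _; rewrite hornerD hornerZ.
  rewrite (_ : _ \o _ = EFin \o (horner (c *: f))); first exact: int_horner.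
  by apply/funext => x /=; rewrite hornerZ.
exact: int_horner.
Qed.

Lemma Rintegral_scale (A : set (measurableTypeR R)) c (f : {poly R}) :
  measurable A -> \int[mu]_(x in A) (c *: f).[x] = c * \int[mu]_(x in A) f.[x].
Proof.
move=> mA; rewrite -[c *: f]addr0 Rintegral_lin//.
under [X in _ + X]eq_Rintegral do rewrite horner0.
by rewrite Rintegral_cst// mul0r addr0.
Qed.

(** Here and in the next lemma a column of the operator is solved for its last basis vector: this is
    the recurrence of [jacobi_poly] with the operator in place of X. *)
Lemma basis_vec1E : basis_vec R 1 =
  (a 1)^-1 *: ((- b 1) *: basis_vec R 0 + jacobi a b (basis_vec R 0)).
Proof.
rewrite jacobi_basis0; apply/funext => i; rewrite !(addE, scaleE).
by field; exact: a_neq0.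
Qed.

Lemma basis_vecSSE n : basis_vec R n.+2 = (a n.+2)^-1 *: ((- b n.+2) *: basis_vec R n.+1 +
   ((- a n.+1) *: basis_vec R n + jacobi a b (basis_vec R n.+1))).
Proof.
rewrite jacobi_basisS; apply/funext => i; rewrite !(addE, scaleE).
by field; exact: a_neq0.
Qed.

Lemma dot_proj_basis u g : ell2 u ->
  (forall A, measurable A -> dot u (E A (basis_vec R 0)) = \int[mu]_(x in A) g.[x]) ->
  forall n A, measurable A ->
  dot u (E A (basis_vec R n)) = \int[mu]_(x in A) (g * jacobi_poly a b n).[x].
Proof.
move=> lu ug n.
have step k f := @dot_proj_op _ _ _ ell2_jacobi jacobi_linear jacobi_sym E_res
  _ T_bound _ _ ell2_delta1 muE u (basis_vec R k) f lu (@ell2_basis R k).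
have dE A c v w : measurable A -> ell2 v -> ell2 w ->
    dot u (E A (c *: v + w)) = c * dot u (E A v) + dot u (E A w).
  move=> mA lv lw; have lEv := proj_ell2 E_res mA lv; have lEw := proj_ell2 E_res mA lw.
  by rewrite (proj_lin E_res c mA lv lw) (dotDr (ell2Z lEv) lEw lu) (dotZr c lEv lu).
have dZ A c v : measurable A -> ell2 v ->
    dot u (E A (c *: v)) = c * dot u (E A v).
  by move=> mA lv; rewrite (projZ E_res c mA lv) (dotZr c (proj_ell2 E_res mA lv) lu).
suff H : (forall A, measurable A ->
    dot u (E A (basis_vec R n)) = \int[mu]_(x in A) (g * jacobi_poly a b n).[x])
  /\ (forall A, measurable A ->
    dot u (E A (basis_vec R n.+1)) = \int[mu]_(x in A) (g * jacobi_poly a b n.+1).[x])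
  by exact: H.1.
elim: n => [|n [IH1 IH2]].
  split => A mA; first by rewrite ug// mulr1.
  have l0 := @ell2_basis R 0; have lT := ell2_jacobi l0.
  rewrite basis_vec1E (dZ _ _ _ mA (ell2D (ell2Z l0) lT)).
  rewrite (dE _ _ _ _ mA l0 lT) (ug _ mA) (step _ _ ug _ mA).
  rewrite -(Rintegral_lin _ _ _ mA) -(Rintegral_scale _ _ mA).
  congr Rintegral; apply/funext => x; congr (_.[_]).
  by rewrite jacobi_poly1 -!mul_polyC polyCN; ring.
split => // A mA.
have l0 := @ell2_basis R n; have l1 := @ell2_basis R n.+1.
have lT := ell2_jacobi l1.
have l2 : ell2 (- a n.+1 *: basis_vec R n + jacobi a b (basis_vec R n.+1)).
  exact: ell2D (ell2Z l0) lT.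
rewrite basis_vecSSE (dZ _ _ _ mA (ell2D (ell2Z l1) l2)).
rewrite (dE _ _ _ _ mA l1 l2) (dE _ _ _ _ mA l0 lT) (IH2 _ mA) (IH1 _ mA).
rewrite (step _ _ IH2 _ mA) -!(Rintegral_lin _ _ _ mA) -(Rintegral_scale _ _ mA).
congr Rintegral; apply/funext => x; congr (_.[_]).
by rewrite jacobi_polySS -!mul_polyC !polyCN; ring.
Qed.

(** Two uses of [dot_proj_basis]. The first has left vector e_m; by symmetry of [E A] its base case
    is the second, with left vector e_0 and density 1, which starts from the definition of [mu]. *)
Lemma dot_basis_proj m n A : measurable A ->
  dot (basis_vec R m) (E A (basis_vec R n))
    = \int[mu]_(x in A) (jacobi_poly a b m * jacobi_poly a b n).[x].
Proof.
apply: dot_proj_basis n A => [|A mA]; first exact: ell2_basis.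
have l0 := @ell2_basis R 0.
rewrite -(proj_sym E_res mA (@ell2_basis R m) l0) dotC -[jacobi_poly a b m]mul1r; move: m A mA.
apply: dot_proj_basis => // A mA.
under eq_Rintegral do rewrite hornerC.
rewrite Rintegral_cst// mul1r.
by rewrite -[LHS]/(fine (dot (@delta1 R) (E A (@delta1 R)))%:E); congr fine; exact/esym/muE.
Qed.

Lemma jacobi_poly_orthonormal :
  orthonormal_family (fun f : {poly R} => \int[mu]_x f.[x]) (jacobi_poly a b).
Proof.
split=> [n|n m]; first exact: size_jacobi_poly.
by rewrite -dot_basis_proj// (proj_setT E_res) ?dot_basis//; exact: ell2_basis.
Qed.

Lemma orthonormal_polynomials_scale (p : nat -> {poly R}) n :
  orthonormal_polynomials mu p ->
  exists2 c, c != 0 & p n = c *: jacobi_poly a b n.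
Proof.
move=> [szp op]; apply: (family_unique (L := fun f : {poly R} => \int[mu]_x f.[x])).
- by move=> c f g; exact: Rintegral_lin.
- split=> [k|k l]; first exact: (szp k).1.
  rewrite /Rintegral; under eq_integral do rewrite hornerM.
  by rewrite op.
- exact: jacobi_poly_orthonormal.
Qed.

End JacobiOperator.

(** * Approximate eigenvalues of truncated Jacobi matrices *)

Section HermitianApprox.
Variables (C : numClosedFieldType) (n : nat).
Implicit Types (A P : 'M[C]_n) (v w : 'rV[C]_n).

Definition sqnorm w : C := \sum_i `|w 0 i| ^+ 2.

Lemma sqnormE w : sqnorm w = (w *m (map_mx Num.conj w^T)) 0 0.
Proof. by rewrite mxE; apply: eq_bigr => i _; rewrite !mxE normCK. Qed.

Lemma sqnorm_unitary P w : P \is unitarymx -> sqnorm (w *m P) = sqnorm w.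
Proof.
move=> uP; rewrite !sqnormE trmx_mul map_mxM mulmxA.
by rewrite -(mulmxA w) (unitarymxP uP) mulmx1.
Qed.

(** Diagonalize [A] by a unitary matrix. If every eigenvalue were farther than e from c, A - c would
    stretch each nonzero coordinate in the eigenbasis by more than e. *)
Lemma hermitian_approx_eigenvalue A v (c e : C) : A \is hermsymmx ->
  v != 0 -> 0 <= e -> sqnorm (v *m A - c *: v) <= e ^+ 2 * sqnorm v ->
  exists2 d, eigenvalue A d & d \is Num.real /\ `|d - c| <= e.
Proof.
move=> hA v0 e0 hv.
set P := spectralmx A; set D := spectral_diag A.
have uP : P \is unitarymx := spectral_unitarymx A.
have uP' : P \in unitmx := spectral_unit A.
have AE : A = invmx P *m diag_mx D *m P.
  exact/orthomx_spectralP/hermitian_normalmx.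
suff [i hi] : exists i, `|D 0 i - c| <= e.
  exists (D 0 i); last first.
    by split=> //; have /mxOverP := hermitian_spectral_diag_real hA; apply.
  apply/eigenvalueP; exists (row i P).
    rewrite -row_mul AE !mulmxA mulmxV// mul1mx; apply/rowP => j.
    by rewrite mul_diag_mx !mxE.
  apply/negP => /eqP r0; have /unitarymxP/matrixP/(_ i i) := uP.
  rewrite !mxE eqxx big1; first by move/eqP; rewrite eq_sym oner_eq0.
  by move=> j _; have /rowP/(_ j) := r0; rewrite !mxE => ->; rewrite mul0r.
pose w := v *m invmx P.
have vE : v = w *m P by rewrite /w mulmxKV.
have rE : v *m A - c *: v = (w *m diag_mx D - c *: w) *m P.
  by rewrite mulmxBl -scalemxAl -vE AE !mulmxA.
have w0 : w != 0 by apply: contra v0 => /eqP w0; rewrite vE w0 mul0mx.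
clearbody w; rewrite rE vE !sqnorm_unitary// in hv.
apply/existsP; rewrite -[X in is_true X]negbK negb_exists; apply/negP => /forallP H.
have {}H i : e < `|D 0 i - c|.
  by rewrite real_ltNge ?H ?normr_real ?ger0_real.
have [i wi] : exists i, w 0 i != 0.
  apply/existsP; rewrite -[X in is_true X]negbK negb_exists; apply/negP => /forallP h.
  by move/negP: w0; apply; apply/eqP/rowP => i; rewrite [RHS]mxE; have := h i; rewrite negbK => /eqP.
have : e ^+ 2 * sqnorm w < sqnorm (w *m diag_mx D - c *: w).
  rewrite /sqnorm mulr_sumr [ltLHS](bigD1 i)//= [ltRHS](bigD1 i)//=.
  have E j : `|(w *m diag_mx D - c *: w) 0 j| ^+ 2 = `|D 0 j - c| ^+ 2 * `|w 0 j| ^+ 2.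
    by rewrite mul_mx_diag !mxE [w 0 j * _]mulrC -mulrBl normrM exprMn.
  have e2 j : e ^+ 2 < `|D 0 j - c| ^+ 2 by rewrite ltr_pXn2r ?nnegrE.
  apply: ltr_leD; first by rewrite E ltr_pM2r// exprn_gt0// normr_gt0.
  by apply: ler_sum => j _; rewrite E ler_wpM2r ?exprn_ge0// ltW.
by move=> /lt_le_trans/(_ hv); rewrite ltxx.
Qed.

End HermitianApprox.

(** Over the complexification [R[i]] the Hermitian case applies; the eigenvalue found there is real
    and descends to R. *)
Lemma symmetric_approx_eigenvalue (R : rcfType) (n : nat) (A : 'M[R]_n)
    (v : 'rV[R]_n) (c e : R) : A^T = A -> v != 0 -> 0 <= e ->
  \sum_i (v *m A - c *: v) 0 i ^+ 2 <= e ^+ 2 * \sum_i v 0 i ^+ 2 ->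
  exists2 x, eigenvalue A x & `|x - c| <= e.
Proof.
move=> symA v0 e0 hv.
pose f : {rmorphism R -> R[i]} := real_complex R.
have fR x : f x \is Num.real by apply/complex_realP; exists x.
have fn x : `|f x| = f `|x| by rewrite normc_def/= expr0n addr0 sqrtr_sqr.
have fle x y : (f x <= f y) = (x <= y) by rewrite lecR.
have [||||d eA [dR dc]] := @hermitian_approx_eigenvalue R[i] n (map_mx f A)
    (map_mx f v) (f c) (f e).
- apply: realsym_hermsym.
    apply/is_hermitianmxP; rewrite expr0 scale1r map_mx_id//.
    by apply/matrixP => i j; rewrite !mxE -{1}symA mxE.
  by apply/mxOverP => i j; rewrite mxE.
- by rewrite map_mx_eq0.
- by rewrite -[0](rmorph0 f) fle.
- have sE (u : 'rV[R]_n) : sqnorm (map_mx f u) = f (\sum_i u 0 i ^+ 2).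
    rewrite rmorph_sum; apply: eq_bigr => i _.
    by rewrite mxE fn -rmorphXn real_normK// num_real.
  by rewrite -map_mxM -map_mxZ -map_mxB !sE -rmorphXn -rmorphM fle.
have [x xd] := complex_realP _ dR.
exists x; first by rewrite -(eigenvalue_map f) -[f x]xd.
by rewrite -fle -fn rmorphB -[f x]xd.
Qed.

Section JacobiMatrix.
Variables (R : realType) (a b : nat -> R) (N : nat).
Implicit Types (u : nat -> R).

(** Rows and columns start at 0 whereas the parameters start at 1. Column j holds the coefficients
    of coordinate j of the operator: [a j], [b j.+1], [a j.+1]. *)
Definition jacobi_mx : 'M[R]_N := \matrix_(i, j)
  ((i.+1 == j)%:R * a j + (i == j :> nat)%:R * b j.+1 + (i == j.+1 :> nat)%:R * a j.+1).

Lemma jacobi_mx_sym : jacobi_mx^T = jacobi_mx.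
Proof.
apply/matrixP => i j; rewrite !mxE; move: (nat_of_ord i) (nat_of_ord j) => k l.
have E1 m n : (m.+1 == n)%:R * a n = (n == m.+1)%:R * a m.+1.
  by have [->|h] := eqVneq n m.+1; rewrite ?eqxx ?mul0r.
have E2 : (l == k)%:R * b k.+1 = (k == l)%:R * b l.+1.
  by have [->|h] := eqVneq l k; rewrite ?eqxx ?mul0r.
by rewrite (E1 l k) E2 -(E1 k l) addrC addrA addrAC.
Qed.

Definition row_of u : 'rV[R]_N := \row_i u i.

Lemma sum_basis u k : (forall i, (N <= i)%N -> u i = 0) ->
  \sum_(i < N) u i * (i == k :> nat)%:R = u k.
Proof.
move=> uN; rewrite -(big_mkord xpredT (fun i => u i * (i == k)%:R)).
by rewrite -(dot_fin (basis_vec R k) uN) dotC dot_basis.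
Qed.

Lemma mul_jacobi_mx u : (forall i, (N <= i)%N -> u i = 0) ->
  row_of u *m jacobi_mx = row_of (jacobi a b u).
Proof.
move=> uN; apply/rowP => j; rewrite !mxE.
under eq_bigr do rewrite !mxE !mulrDr !mulrA.
rewrite !big_split/= -!mulr_suml !sum_basis//.
case: (nat_of_ord j) => [|k]; last first.
  by under eq_bigr do rewrite eqSS; rewrite sum_basis// jacobi_atS; ring.
by rewrite big1 ?jacobi_at0; [ring|move=> i _; rewrite mulr0].
Qed.

Hypothesis a_neq0 : forall n, a n.+1 != 0.

(** Extended by 0, an eigenvector satisfies the recurrence in rows 0 to N - 1, so for k up to N its
    coordinate k is u_0 times the k-th polynomial at x. At k = N it is 0, whereas u_0 is not. *)
Lemma eigenvalue_jacobi_mx x : (0 < N)%N -> eigenvalue jacobi_mx x ->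
  root (jacobi_poly a b N) x.
Proof.
move=> N0 /eigenvalueP[v vx v0].
pose u k := if insub k is Some i then v 0 i else 0.
have uN i : (N <= i)%N -> u i = 0 by move=> Ni; rewrite /u insubF// ltnNge Ni.
have uv : v = row_of u by apply/rowP => i; rewrite mxE /u valK.
have ux k : (k < N)%N -> jacobi a b u k = x * u k.
  move=> kN; have := vx; rewrite uv mul_jacobi_mx// => /rowP/(_ (Ordinal kN)).
  by rewrite !mxE.
have H k : (k <= N)%N -> u k = u 0%N * (jacobi_poly a b k).[x] /\
    ((k < N)%N -> u k.+1 = u 0%N * (jacobi_poly a b k.+1).[x]).
  elim: k => [_|k IH kN].
    rewrite jacobi_poly0 hornerC mulr1; split => // _.
    have := ux 0%N N0; rewrite jacobi_at0 => h.
    have -> : u 1%N = (x * u 0%N - b 1 * u 0%N) / a 1 by rewrite -h; field; exact: a_neq0.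
    by rewrite jacobi_poly1 hornerZ hornerXsubC; field; exact: a_neq0.
  have [IH1 /(_ kN) IH2] := IH (ltnW kN); split=> // kN1.
  have := ux _ kN1; rewrite jacobi_atS => h.
  have -> : u k.+2 = (x * u k.+1 - a k.+1 * u k - b k.+2 * u k.+1) / a k.+2.
    by rewrite -h; field; exact: a_neq0.
  by rewrite jacobi_polySS hornerZ hornerD hornerN hornerM hornerXsubC hornerZ IH2 IH1; field; exact: a_neq0.
have [uNE _] := H N (leqnn N).
have u0 : u 0%N != 0.
  apply: contra v0 => /eqP u0; rewrite uv; apply/eqP/rowP => i; rewrite !mxE.
  by have [-> _] := H i (ltnW (ltn_ord i)); rewrite u0 mul0r.
move/eqP: uNE; rewrite uN// eq_sym mulf_eq0 (negbTE u0)/=; exact.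
Qed.

(** The residual is summed over the rows below N only: whatever the operator puts at coordinate N is
    cut off by the truncation. *)
Lemma root_jacobi_near u (c e : R) : (0 < N)%N -> (forall i, (N <= i)%N -> u i = 0) ->
  0 <= e -> (exists i, u i != 0) ->
  \sum_(0 <= i < N) (jacobi a b u i - c * u i) ^+ 2
    <= e ^+ 2 * \sum_(0 <= i < N) u i ^+ 2 ->
  exists2 x, `|x - c| <= e & root (jacobi_poly a b N) x.
Proof.
move=> N0 uN e0 [i ui] h.
have [||//||x ex xc] := @symmetric_approx_eigenvalue R N jacobi_mx (row_of u) c e.
- exact: jacobi_mx_sym.
- apply/negP => /eqP/rowP r0; move/negP: ui; apply.
  have [Ni|iN] := leqP N i; first by rewrite uN.
  by have := r0 (Ordinal iN); rewrite !mxE => ->.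
- move: h; rewrite !big_mkord mul_jacobi_mx//.
  by congr (_ <= _ * _); apply: eq_bigr => k _; rewrite !mxE.
by exists x => //; exact: eigenvalue_jacobi_mx.
Qed.
End JacobiMatrix.

(** * Distance to the spectrum and spectral gaps *)

Section ResolventBound.
Variables (R : realType) (T : (nat -> R) -> (nat -> R)).
Variable E : set (measurableTypeR R) -> (nat -> R) -> (nat -> R).
Hypothesis T_ell2 : forall u, ell2 u -> ell2 (T u).
Hypothesis T_lin : forall (c : R) u v, T (c *: u + v) = c *: T u + T v.
Hypothesis T_sym : forall u v, ell2 u -> ell2 v -> dot (T u) v = dot u (T v).
Hypothesis E_res : spectral_resolution T E.

(** Split v into its parts p above and m below the gap. The vector p - m has the norm of v, and its
    pairing with (T - x) v is at least h |v|^2; [dot_amgm] for h (p - m) concludes. *)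
Lemma resolvent_bound (x h : R) v : ell2 v -> 0 <= h ->
  E `]x - h, x + h[%classic v = 0 ->
  h ^+ 2 * dot v v <= dot (T v - x *: v) (T v - x *: v).
Proof.
move=> lv h0 Ev.
set B : set (measurableTypeR R) := `]x - h, x + h[%classic in Ev.
pose L : set (measurableTypeR R) := `]-oo, x - h]%classic.
(* Removing [L] keeps the two rays disjoint when h = 0. *)
pose U : set (measurableTypeR R) := `[x + h, +oo[%classic `\` L.
have mB : measurable B by exact: measurable_itv.
have mL : measurable L by exact: measurable_itv.
have mU : measurable U by apply: measurableD => //; exact: measurable_itv.
have LU : L `&` U = set0 by rewrite /U setDE setICA setICr setI0.
have UL : U `&` L = set0 by rewrite setIC.
have BC : ~` B = L `|` U.
  apply/seteqP; split => y; rewrite /B /L /U /= !in_itv/= ?andbT.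
    move=> /negP; rewrite negb_and -!leNgt => /orP[|xy]; first by left.
    by have [] := leP y (x - h) => yx; [left|right; split=> //; apply/negP; rewrite -ltNge].
  by move=> [|[]] h1; [|move=> _]; apply/negP; rewrite negb_and -!leNgt h1 ?orbT.
set p := E U v; set m := E L v.
have lp : ell2 p := proj_ell2 E_res mU lv; have lm : ell2 m := proj_ell2 E_res mL lv.
have lTp := T_ell2 lp; have lTm := T_ell2 lm.
have vE : v = p + m.
  by rewrite [LHS](proj_setC E_res mB lv) Ev BC add0r (proj_setU E_res mL mU LU lv) addrC.
have c1 : dot p m = 0 := proj_disj E_res mU mL UL lv lv.
have c2 : dot p (T m) = 0 := op_disj T_ell2 T_lin T_sym E_res mU mL UL lv lv.
have c3 : dot m (T p) = 0 := op_disj T_ell2 T_lin T_sym E_res mL mU LU lv lv.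
have b1 : (x + h) * dot p p <= dot p (T p).
  by apply: (dotT_ge E_res mU lv) => y; rewrite /U => -[/=]; rewrite in_itv/= andbT.
have b2 : dot m (T m) <= (x - h) * dot m m.
  by apply: (dotT_le E_res mL lv) => y; rewrite /L /= in_itv/=.
have vv : dot v v = dot p p + dot m m by rewrite vE (dotDD lp lm) c1 mulr0 addr0.
have zz : dot (p - m) (p - m) = dot v v.
  by rewrite vv (dotBB lp lm) c1 mulr0 subr0.
have lz := ell2B lp lm; have lTv := T_ell2 lv; have lxv := ell2Z (c := x) lv.
have lS := ell2B lTv lxv.
have zS : h * dot v v <= dot (p - m) (T v - x *: v).
  rewrite (dotBr lTv lxv lz) (dotZr x lv lz) vv.
  rewrite {1 2}vE (opD T_lin) (dotBl lp lm (ell2D lTp lTm)) (dotBl lp lm (ell2D lp lm)).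
  rewrite (dotDr lTp lTm lp) (dotDr lTp lTm lm) (dotDr lp lm lp) (dotDr lp lm lm).
  rewrite c2 c3 (dotC m p) c1; lra.
have := dot_amgm (ell2Z (c := h) lz) lS.
rewrite (dotZl h lz lS) (dotZl h lz (ell2Z (c := h) lz)) (dotZr h lz lz) zz.
move=> /(le_trans (ler_wpM2l (ler0n _ 2) (ler_norm _))) => am.
have : h * (h * dot v v) <= h * dot (p - m) (T v - x *: v) by rewrite ler_wpM2l.
rewrite expr2 -mulrA; lra.
Qed.

(* On the spectral subspace of ]-h, h[ the form of T is at most h, against the
   lower bound g. *)
Lemma gap_vanish (S : (nat -> R) -> (nat -> R)) (g h : R) u :
  (forall u, ell2 u -> ell2 (S u)) ->
  (forall u, ell2 u -> dot (S u) (S u) = dot u u) ->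
  (forall u, ell2 u -> g * dot u u <= dot (S u) (T u)) ->
  h < g -> 0 <= h -> ell2 u -> E `]- h, h[%classic u = 0.
Proof.
move=> lS iS gS hg h0 lu; set B : set (measurableTypeR R) := `]- h, h[%classic.
have mB : measurable B by exact: measurable_itv.
have lw := proj_ell2 E_res mB lu; set w := E B u in lw *.
have wE : E B w = w by rewrite /w (proj_idem E_res mB lu).
have Bh y : B y -> 0 - h <= y <= 0 + h.
  by rewrite /B /= in_itv/= sub0r add0r => /andP[/ltW-> /ltW->].
have := dotT_polar T_ell2 T_lin T_sym E_res mB (lS _ lw) lw Bh.
rewrite mul0r subr0 wE => pol.
have sw : dot (S w) (E B (S w)) <= dot w w.
  have mB' := measurableC mB; have lSw := lS _ lw.
  rewrite -(iS _ lw) [in leRHS](proj_setC E_res mB lSw).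
  have l1 := proj_ell2 E_res mB lSw; have l2 := proj_ell2 E_res mB' lSw.
  rewrite (dotDD l1 l2) (proj_disj E_res mB mB') ?setICr// mulr0 addr0.
  by rewrite -(dot_proj E_res mB lSw) lerDl dot_ge0.
have gw := gS _ lw; have w0 := dot_ge0 lw.
have nw := ler_norm (dot (S w) (T w)).
have hs : h * (dot (S w) (E B (S w)) + dot w w) <= h * (dot w w + dot w w).
  by rewrite ler_wpM2l// lerD2r.
apply: dot_eq0 => //; apply/eqP; rewrite eq_le w0 andbT leNgt; apply/negP => wp.
have : h * dot w w < g * dot w w by rewrite ltr_pM2r.
lra.
Qed.

End ResolventBound.

(** * The dyadic enumeration *)

Section Beta.
Variable R : realType.

Lemma dyadic_block_lt1 k x : x \in @dyadic_block R k -> `|x| < 1.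
Proof.
rewrite /dyadic_block /mkseq => /mapP[i iP ->]; move: iP; rewrite mem_iota add0n => /andP[_ ik].
have k0 : 0 < 2 ^+ k :> R by rewrite exprn_gt0.
rewrite normrM normfV (gtr0_norm k0) ltr_pdivrMr// mul1r ltr_norml.
have : (i.+1 < 2 ^ k.+1)%N by lia.
rewrite -(ltr_nat R) natrX exprS => i1.
by apply/andP; split; [rewrite ltrBrDr addNr ltr0n|lra].
Qed.

Lemma beta_lt1 n : `|beta R n| < 1.
Proof.
rewrite /beta; set s := flatten _; have [ns|sn] := ltnP n.-1 (size s); last first.
  by rewrite nth_default// normr0.
have /flattenP[_ /mapP[k _ ->] ] := mem_nth 0 ns; exact: dyadic_block_lt1.
Qed.

Lemma size_dyadic_block k : size (@dyadic_block R k) = (2 ^ k.+1 - 1)%N.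
Proof. exact: size_mkseq. Qed.

Lemma leq_size_dyadic_blocks k : (k <= size (flatten (mkseq (@dyadic_block R) k)))%N.
Proof.
elim: k => // k IH; rewrite -addn1 /mkseq iotaD map_cat flatten_cat size_cat.
rewrite leq_add// /= cats0 size_dyadic_block.
by have := expn_gt0 2 k; rewrite expnS; lia.
Qed.

(** Block k starts after the s terms of the earlier blocks, and s >= k since blocks are nonempty; so
    each of its values occurs at an index beyond k. *)
Lemma beta_block k i : (i < 2 ^ k.+1 - 1)%N ->
  exists2 n, (k < n)%N & beta R n = (i.+1%:R - 2 ^+ k) / 2 ^+ k.
Proof.
move=> ik; set s := size (flatten (mkseq (@dyadic_block R) k)).
have ks : (k <= s)%N := leq_size_dyadic_blocks k.
exists (s + i).+1; first by rewrite ltnS (leq_trans ks)// leq_addr.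
(* Splits the number of blocks read by [beta] into k plus a positive remainder, to expose block
   k. *)
have -> : beta R (s + i).+1 =
    nth 0 (flatten (mkseq (@dyadic_block R) (k + (s + i - k).+1))) (s + i).
  by rewrite /beta; congr (nth _ (flatten (mkseq _ _)) _); lia.
rewrite {1}/mkseq iotaD map_cat flatten_cat nth_cat -/(mkseq _ k) -/s.
rewrite ltnNge leq_addr/= addKn nth_cat size_dyadic_block add0n ik.
by rewrite nth_mkseq.
Qed.

(** A dyadic grid of mesh below r - l has a point in the interval; taking k >= m pushes its index
    beyond m. *)
Lemma beta_dense (l r : R) m : -1 <= l -> l < r -> r <= 1 ->
  exists2 n, (m <= n)%N & l < beta R n < r.
Proof.
move=> l1 lr r1.
pose k := maxn m (Num.truncn (r - l)^-1).
have k2 : (r - l)^-1 < 2 ^+ k.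
  apply: lt_le_trans (truncnS_gt _) _; rewrite -natrX ler_nat.
  by apply: leq_ltn_trans (leq_maxr m _) _; exact: ltn_expl.
have k0 : 0 < 2 ^+ k :> R by rewrite exprn_gt0.
have rl : 0 < r - l by rewrite subr_gt0.
have k3 : 1 < (r - l) * 2 ^+ k by rewrite -ltr_pdivrMl// mulr1.
(* The number of grid steps from -1 to l, rounded down: the next grid point lies strictly to the
   right of l. *)
pose i := Num.truncn ((l + 1) * 2 ^+ k).
have l0 : 0 <= (l + 1) * 2 ^+ k.
  by rewrite mulr_ge0 ?(ltW k0)// -lerBlDr sub0r.
have /andP[i1 i2] : i%:R <= (l + 1) * 2 ^+ k < i.+1%:R by exact: truncn_itv.
have i3 : i.+1%:R < (r + 1) * 2 ^+ k.
  have -> : (r + 1) * 2 ^+ k = (l + 1) * 2 ^+ k + (r - l) * 2 ^+ k by ring.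
  by rewrite -natr1; exact: ler_ltD.
have ik : (i < 2 ^ k.+1 - 1)%N.
  rewrite ltn_subRL add1n -(ltr_nat R) natrX exprS; apply: lt_le_trans i3 _.
  by rewrite ler_wpM2r ?(ltW k0)//; lra.
have [n kn bE] := beta_block ik.
exists n; first exact: leq_trans (leq_maxl m _) (ltnW kn).
rewrite bE ltr_pdivlMr// ltr_pdivrMr// ltrBrDr ltrBlDr.
by rewrite -[X in _ + X]mul1r -mulrDl i2 -[X in _ < _ + X]mul1r -mulrDl i3.
Qed.
End Beta.

(** * The operator with off-diagonal entries 3, 1, 3, 1 ... *)

Section PeriodTwoModel.
Variables (R : realType) (a b : nat -> R).
Hypothesis ha_odd : forall n, (1 <= n)%N -> a (2 * n - 1)%N = 3.
Hypothesis ha_even : forall n, (1 <= n)%N -> a (2 * n)%N = 1.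
Hypothesis hb1 : b 1%N = beta R 1.
Hypothesis hb : forall n k, (1 <= n)%N -> (2 * n ^ 2 <= k < 2 * n.+1 ^ 2)%N ->
  b k = beta R n.
Implicit Types u v x z : nat -> R.

Lemma model_a_odd t : a t.*2.+1 = 3.
Proof. by rewrite -(ha_odd (ltn0Sn t)); congr a; lia. Qed.

Lemma model_a_even t : a t.*2.+2 = 1.
Proof. by rewrite -(ha_even (ltn0Sn t)); congr a; lia. Qed.

Lemma model_aS i : a i.+1 = if odd i then 1 else 3.
Proof.
rewrite -(odd_double_half i); case: (odd i); rewrite ?add1n ?add0n /= odd_double/=.
  exact: model_a_even.
exact: model_a_odd.
Qed.

Lemma model_a_neq0 i : a i.+1 != 0.
Proof. by rewrite model_aS; case: odd; rewrite ?oner_neq0 ?pnatr_eq0. Qed.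

Lemma model_a_le3 i : `|a i.+1| <= 3.
Proof. by rewrite model_aS; case: odd; rewrite ger0_norm//; lra. Qed.

Lemma model_b_le1 i : `|b i.+1| <= 1.
Proof.
case: i => [|i]; first by rewrite hb1 ltW// beta_lt1.
have ex : exists n, (2 * n ^ 2 <= i.+2)%N by exists 0%N.
have bd n : (2 * n ^ 2 <= i.+2)%N -> (n <= i.+2)%N by move=> h; nia.
(* The block of an index is given by the largest n with 2 n^2 not above that index. *)
case: (ex_maxnP ex bd) => n hn mx.
have n1 : (1 <= n)%N by apply: mx; lia.
rewrite (hb n1) ?ltW ?beta_lt1// hn/= ltnNge; apply/negP => /mx.
by rewrite ltnn.
Qed.

Lemma model_b_le3 i : `|b i.+1| <= 3.
Proof. by apply: le_trans (model_b_le1 i) _; lra. Qed.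

Let K0 : 0 <= 3 :> R. Proof. by []. Qed.

Lemma model_ell2 u : ell2 u -> ell2 (jacobi a b u).
Proof. exact: (ell2_jacobi K0 model_a_le3 model_b_le3). Qed.

Lemma model_sym u v : ell2 u -> ell2 v ->
  dot (jacobi a b u) v = dot u (jacobi a b v).
Proof. exact: (jacobi_sym K0 model_a_le3 model_b_le3). Qed.

(** The pairs 2k, 2k+1 are coupled by 3, the pairs 2k+1, 2k+2 by 1. The second coupling is [swap]
    moved by one place, with coordinate 0 sent to 0. *)
Lemma model_decomp u : jacobi a b u =
  3 *: swap u + shiftr (swap (shiftl u)) + diag_op b u.
Proof.
apply/funext => i.
transitivity (3 * swap u i + shiftr (swap (shiftl u)) i + b i.+1 * u i : R); last by [].
case: i => [|i]; first by rewrite jacobi_at0 model_aS /swap/=; ring.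
rewrite jacobi_atS !model_aS /swap/= /shiftl /=.
case: (boolP (odd i)) => oi /=; last by ring.
by case: i oi => //= i oi; ring.
Qed.

Section Forms.
Variable u : nat -> R.
Hypothesis lu : ell2 u.
Let ls := ell2_swap lu.
Let lc : ell2 (shiftr (swap (shiftl u))) := ell2_shiftr (ell2_swap (ell2_shiftl lu)).
Let lb : ell2 (diag_op b u) := ell2_diag K0 model_b_le3 lu.

Let norm_c : dot (shiftr (swap (shiftl u))) (shiftr (swap (shiftl u))) <= dot u u.
Proof.
rewrite (dot_shiftr2 (ell2_swap (ell2_shiftl lu))) (dot_swap (ell2_shiftl lu) (ell2_shiftl lu)).
exact: dot_shiftl_le.
Qed.

Let norm_b : dot (diag_op b u) (diag_op b u) <= dot u u.
Proof.
have := @dot_le_bounded R 1 u (diag_op b u) ler01 _ lu.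
rewrite expr1n mul1r; apply => i.
by rewrite normrM ler_wpM2r// model_b_le1.
Qed.

Lemma dot_model v : ell2 v -> dot v (jacobi a b u) = 3 * dot v (swap u)
  + dot v (shiftr (swap (shiftl u))) + dot v (diag_op b u).
Proof.
move=> lv; have l3 := ell2Z (c := 3) ls.
rewrite model_decomp (dotDr (ell2D l3 lc) lb lv) (dotDr l3 lc lv).
by rewrite (dotZr _ ls lv).
Qed.

(** The three terms of the decomposition contribute 3, 1 and 1. *)
Lemma model_bound : `|dot u (jacobi a b u)| <= 5 * dot u u.
Proof.
rewrite (dot_model lu).
have h1 := dot_amgm lu ls; rewrite (dot_swap lu lu) in h1.
have h2 := dot_amgm lu lc; have h3 := dot_amgm lu lb.
apply: le_trans (ler_normD _ _) _; apply: le_trans (lerD (ler_normD _ _) (lexx _)) _.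
rewrite normrM ger0_norm//; have := norm_c; have := norm_b; lra.
Qed.

(** The main term gives 3 |u|^2 since [swap] is an isometry; each of the two contractions takes away
    at most |u|^2. *)
Lemma model_gap : 1 * dot u u <= dot (swap u) (jacobi a b u).
Proof.
rewrite (dot_model ls) (dot_swap lu lu).
have := dot_amgm ls lc; have := dot_amgm ls lb.
rewrite (dot_swap lu lu); have := norm_c; have := norm_b.
have := ler_norm (- dot (swap u) (shiftr (swap (shiftl u)))).
have := ler_norm (- dot (swap u) (diag_op b u)); rewrite !normrN.
lra.
Qed.

End Forms.

(** Groups the coordinates into cells of two sites, with x on the first sites and z on the second
    ones. *)
Definition interleave x z : nat -> R := fun k => if odd k then z k./2 else x k./2.

Lemma interleave_even x z t : interleave x z t.*2 = x t.
Proof. by rewrite /interleave odd_double doubleK. Qed.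

Lemma interleave_odd x z t : interleave x z t.*2.+1 = z t.
Proof. by rewrite /interleave /= odd_double /= uphalf_double. Qed.

Lemma jacobi_interleave_even x z t :
  jacobi a b (interleave x z) t.+1.*2 = z t + b t.+1.*2.+1 * x t.+1 + 3 * z t.+1.
Proof.
rewrite doubleS jacobi_atS model_a_even -doubleS model_a_odd.
by rewrite !interleave_even !interleave_odd mul1r.
Qed.

Lemma jacobi_interleave_odd x z t :
  jacobi a b (interleave x z) t.*2.+1 = 3 * x t + b t.*2.+2 * z t + x t.+1.
Proof.
rewrite jacobi_atS model_a_odd model_a_even -doubleS.
by rewrite !interleave_even !interleave_odd mul1r.
Qed.

Lemma sum_double (f : nat -> R) n :
  \sum_(0 <= k < n.*2) f k = \sum_(0 <= t < n) (f t.*2 + f t.*2.+1).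
Proof.
elim: n => [|n IH]; first by rewrite !big_nil.
by rewrite doubleS !big_nat_recr//= IH addrA.
Qed.

Lemma sum_indicator (c : R) s n : (s < n)%N ->
  \sum_(0 <= t < n) c * (t == s)%:R = c.
Proof.
move=> sn; rewrite big_mkord (bigD1 (Ordinal sn))//= eqxx mulr1 big1 ?addr0// => i.
by rewrite -val_eqE /= => /negbTE ->; rewrite mulr0.
Qed.

Lemma model_b_block n t : (1 <= n)%N -> (n ^ 2 <= t <= n ^ 2 + 2 * n)%N ->
  b t.*2.+1 = beta R n.
Proof. by move=> n1 /andP[t1 t2]; apply: hb => //; apply/andP; split; nia. Qed.

(** The upper bound on t is strict here: the second site of cell n^2 + 2n has parameter index 2
    (n+1)^2, the first one of the next block. *)
Lemma model_b_blockS n t : (1 <= n)%N -> (n ^ 2 <= t < n ^ 2 + 2 * n)%N ->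
  b t.*2.+2 = beta R n.
Proof. by move=> n1 /andP[t1 t2]; apply: hb => //; apply/andP; split; nia. Qed.

(** The edge state, rescaled to start at 1 in cell n^2. It has residual 1 in a single row, while its
    last entry has absolute value 3^(2n). *)
Lemma root_near_beta n : (1 <= n)%N ->
  exists2 x, `|x - beta R n| <= (3 ^+ (2 * n))^-1
    & root (jacobi_poly a b (2 * n.+1 ^ 2 - 1)) x.
Proof.
move=> n1; set s := (n ^ 2)%N; set m := (s + 2 * n)%N.
have s0 : (0 < s)%N by rewrite /s expn_gt0 n1.
have -> : (2 * n.+1 ^ 2 - 1)%N = m.*2.+1 by rewrite /m /s; nia.
(* The ratio -3 solves 3 x(t) + x(t+1) = 0 on the second sites; the starting value 1 leaves the
   residual 1 on the site just before cell s. *)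
pose x t : R := if (s <= t <= m)%N then (- 3) ^+ (t - s) else 0.
pose z (_ : nat) : R := 0.
pose u := interleave x z.
have xm t : (m < t)%N -> x t = 0 by move=> mt; rewrite /x [(t <= m)%N]leqNgt mt andbF.
have uN k : (m.*2.+1 <= k)%N -> u k = 0.
  rewrite /u /interleave => mk; case: ifP => // /negbT ok.
  by apply: xm; move: mk ok; lia.
apply: (@root_jacobi_near R a b m.*2.+1 model_a_neq0 u) => //.
- exists s.*2; rewrite /u interleave_even /x leqnn leq_addr/= subnn expr0.
  exact: oner_neq0.
have even0 t : jacobi a b u t.*2 - beta R n * u t.*2 = 0.
  have bx : b t.*2.+1 * x t = beta R n * x t.
    rewrite /x; case: ifP => [h|]; last by rewrite !mulr0.
    by rewrite (model_b_block n1 h).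
  rewrite /u interleave_even -bx; case: t bx => [|t] bx.
    by rewrite jacobi_at0 /interleave/= /z mulr0 addr0 subrr.
  by rewrite jacobi_interleave_even /z mulr0 addr0 add0r subrr.
(* Second sites stop before cell m: that of cell m is coordinate N, which the truncation cuts
   off. *)
have odd1 t : (t < m)%N -> jacobi a b u t.*2.+1 - beta R n * u t.*2.+1 = 1 * (t == s.-1)%:R.
  move=> tm; rewrite /u interleave_odd /z mulr0 subr0 jacobi_interleave_odd mulr0 addr0 mul1r.
  have [->|ts] := eqVneq t s.-1.
    by rewrite /x prednK// leqnn leq_addr/= subnn [(s <= s.-1)%N]leqNgt prednK// leqnn/= mulr0 add0r.
  have [st|st] := leqP s t.
    rewrite /x st (ltnW tm)/= leqW//= tm subSn// exprS.
    by rewrite mulNr addrN.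
  by rewrite /x [(s <= t)%N]leqNgt st/= mulr0 add0r ifF//; apply/negbTE; lia.
rewrite big_nat_recr//= even0 expr0n addr0 sum_double.
rewrite (eq_big_nat _ _ (F2 := fun t => 1 * (t == s.-1)%:R)); last first.
  move=> t /andP[_ tm]; rewrite even0 (odd1 _ tm) expr0n add0r mul1r.
  by case: (t == s.-1); rewrite ?expr1n ?expr0n.
rewrite sum_indicator; last by rewrite /m; lia.
have h1 : x m ^+ 2 <= \sum_(0 <= k < m.*2.+1) u k ^+ 2.
  have um : u m.*2 = x m by rewrite /u interleave_even.
  rewrite big_nat_recr//= um lerDr sumr_ge0// => i _.
  exact: sqr_ge0.
have xmE : x m ^+ 2 = (3 ^+ (2 * n)) ^+ 2.
  by rewrite /x /m leq_addr leqnn/= addKn -!exprM mulnC !exprM sqrrN.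
apply: le_trans (ler_wpM2l (sqr_ge0 _) h1).
by rewrite xmE -exprMn mulVf ?expr1n// expf_neq0// pnatr_eq0.
Qed.

End PeriodTwoModel.

(** * Approximate eigenvectors in the bands *)

Section Oscillation.
Variables (R : realType) (c : R).

(* For c = cos t this is sin (j t) / sin t. *)
Definition osc (j : nat) : R := (iter j (fun p => (p.2, 2 * c * p.2 - p.1)) (0, 1)).1.

Lemma oscSS j : osc j.+2 = 2 * c * osc j.+1 - osc j.
Proof. by []. Qed.

(** A quadratic form conserved by the recurrence. For |c| < 1 it is positive definite, whence the
    two bounds below, uniform in j. *)
Lemma osc_invariant j :
  osc j ^+ 2 + osc j.+1 ^+ 2 - 2 * c * (osc j * osc j.+1) = 1.
Proof.
elim: j => [|j IH]; first by rewrite /osc/=; ring.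
by rewrite -[RHS]IH oscSS; ring.
Qed.

Hypothesis c1 : `|c| < 1.

Lemma osc_lower j : 1 <= 2 * (osc j ^+ 2 + osc j.+1 ^+ 2).
Proof.
have := osc_invariant j; move: c1; rewrite ltr_norml => /andP[? ?].
have := sqr_ge0 (osc j + osc j.+1); have := sqr_ge0 (osc j - osc j.+1).
move: (osc j) (osc j.+1) => w w' h1 h2 h3.
have k1 : 0 <= (1 - c) * (w - w') ^+ 2 by rewrite mulr_ge0//; lra.
have k2 : 0 <= (1 + c) * (w + w') ^+ 2 by rewrite mulr_ge0//; lra.
have : 2 * (w ^+ 2 + w' ^+ 2) - 1 =
  (2 * (w ^+ 2 + w' ^+ 2) - (w ^+ 2 + w' ^+ 2 - 2 * c * (w * w'))) by rewrite h3.
have -> : 2 * (w ^+ 2 + w' ^+ 2) - (w ^+ 2 + w' ^+ 2 - 2 * c * (w * w'))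
  = ((1 - c) * (w - w') ^+ 2 + (1 + c) * (w + w') ^+ 2) / 2 by field.
lra.
Qed.

Lemma osc_upper j : osc j ^+ 2 <= (1 - `|c|)^-1.
Proof.
have c0 : 0 < 1 - `|c| by rewrite subr_gt0.
rewrite -[leRHS]mul1r ler_pdivlMr//.
have := osc_invariant j; move: (osc j) (osc j.+1) => w w' h.
have k1 : 0 <= (1 - `|c|) * w' ^+ 2 by rewrite mulr_ge0 ?sqr_ge0// ltW.
have k2 : 2 * c * (w * w') <= `|c| * (w ^+ 2 + w' ^+ 2).
  have [cp|cn] := leP 0 c.
    have : 0 <= c * (w - w') ^+ 2 by rewrite mulr_ge0 ?sqr_ge0.
    by rewrite ger0_norm//; lra.
  have : 0 <= (- c) * (w + w') ^+ 2 by rewrite mulr_ge0 ?sqr_ge0// oppr_ge0 ltW.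
  by rewrite ltr0_norm//; lra.
lra.
Qed.

End Oscillation.

Section Weyl.
Variables (R : realType) (a b : nat -> R).
Hypothesis ha_odd : forall n, (1 <= n)%N -> a (2 * n - 1)%N = 3.
Hypothesis ha_even : forall n, (1 <= n)%N -> a (2 * n)%N = 1.
Hypothesis hb : forall n k, (1 <= n)%N -> (2 * n ^ 2 <= k < 2 * n.+1 ^ 2)%N ->
  b k = beta R n.
Variables (y c : R) (n : nat).

Let s := (n ^ 2)%N.
Let M := (2 * n)%N.
Let w := osc c.
(* Eliminating the odd sites from (T - beta_n) u = y u inside the block leaves
   3 w(j-1) + 10 w(j) + 3 w(j+1) = y^2 w(j), hence y^2 = 10 + 6 c below. *)
Let x t : R := if (s <= t < s + M)%N then y * w (t - s)%N else 0.
Let z t : R := if (s <= t < s + M)%N then 3 * w (t - s)%N + w (t - s).+1 else 0.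
(** The support consists of the cells s to s + 2n - 1, which have both sites in block n; the second
    site of the next cell has left it. *)
Definition weyl : nat -> R := interleave x z.
Let r : nat -> R := jacobi a b weyl - (beta R n + y) *: weyl.

Let rE k : r k = jacobi a b weyl k - (beta R n + y) * weyl k. Proof. by []. Qed.

Let x_in j : (j < M)%N -> x (s + j)%N = y * w j.
Proof. by move=> jM; rewrite /x leq_addr ltn_add2l jM/= addKn. Qed.

Let z_in j : (j < M)%N -> z (s + j)%N = 3 * w j + w j.+1.
Proof. by move=> jM; rewrite /z leq_addr ltn_add2l jM/= addKn. Qed.

Let x_lt t : (t < s)%N -> x t = 0.
Proof. by move=> ts; rewrite /x [(s <= t)%N]leqNgt ts. Qed.

Let z_lt t : (t < s)%N -> z t = 0.
Proof. by move=> ts; rewrite /z [(s <= t)%N]leqNgt ts. Qed.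

Let x_ge t : (s + M <= t)%N -> x t = 0.
Proof. by move=> ts; rewrite /x ltnNge ts andbF. Qed.

Let z_ge t : (s + M <= t)%N -> z t = 0.
Proof. by move=> ts; rewrite /z ltnNge ts andbF. Qed.

Lemma weyl_supp k : ((s + M).*2 <= k)%N -> weyl k = 0.
Proof.
by move=> sk; rewrite /weyl /interleave; case: ifP => ok; [apply: z_ge|apply: x_ge];
  rewrite -leq_double; move: ok sk; lia.
Qed.

Hypothesis n1 : (1 <= n)%N.

Let s0 : (0 < s)%N. Proof. by rewrite /s expn_gt0 n1. Qed.
Let M0 : (0 < M)%N. Proof. by rewrite /M muln_gt0. Qed.

Let w0 : w 0 = 0. Proof. by []. Qed.
Let w1 : w 1 = 1. Proof. by []. Qed.

Let sM_neq : (s == s + M)%N = false.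
Proof. by apply/eqP => h; move: M0; lia. Qed.

Hypothesis yc : y ^+ 2 = 10 + 6 * c.

(** Inside the block x and z are chosen to cancel everything. On the left, w(0) = 0 and w(1) = 1
    leave 3; on the right, the last z leaks into cell s + M. *)
Let r_even t : r t.*2 = 3 * (t == s)%:R + (3 * w M.-1 + w M) * (t == s + M)%N%:R.
Proof.
rewrite rE /weyl interleave_even; case: t => [|t].
  rewrite jacobi_at0 -[0%N]/(0.*2) -[1%N]/(0.*2.+1) interleave_even interleave_odd.
  by rewrite x_lt// z_lt// !(ltn_eqF)//=; [ring|lia].
rewrite (jacobi_interleave_even b ha_odd ha_even).
have [ts|st] := ltnP t.+1 s.
  by rewrite x_lt// z_lt ?(ltnW ts)// (z_lt ts) ltn_eqF// ltn_eqF ?ltn_addr// /=; ring.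
have [j tj] : exists j, t.+1 = (s + j)%N by exists (t.+1 - s)%N; rewrite subnKC.
rewrite tj; case: j tj => [|j] tj.
  rewrite addn0 eqxx sM_neq.
  have := x_in M0; have := z_in M0; rewrite addn0 => -> ->.
  have ts : (t < s)%N by lia.
  by rewrite (z_lt ts) w0 w1 /=; ring.
have -> : t = (s + j)%N by lia.
have -> : (s + j.+1 == s)%N = false by apply/eqP; lia.
rewrite eqn_add2l.
have [jM|Mj] := ltnP j.+1 M.
  rewrite !z_in ?(ltnW jM)// x_in// ltn_eqF//.
  rewrite (model_b_block hb n1); last by rewrite -/s; move: jM; rewrite /M; lia.
  have wE : w j.+2 = 2 * c * w j.+1 - w j := oscSS c j.
  (* After the recurrence of w, the relation between y and c is the only remaining factor. *)
  transitivity ((10 + 6 * c - y ^+ 2) * w j.+1); first by rewrite wE /=; ring.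
  by rewrite yc subrr mul0r /=; ring.
rewrite x_ge ?leq_add2l// (z_ge (t := (s + j.+1)%N)) ?leq_add2l//.
move: Mj; rewrite leq_eqVlt => /predU1P[Mj|Mj].
  by rewrite Mj eqxx /= z_in -?Mj// /=; ring.
by rewrite z_ge ?leq_add2l// gtn_eqF// /=; ring.
Qed.

(** The only term left comes from the missing right neighbour x(s + M); cell s - 1 leaves none
    because x(s) = y w(0) = 0. *)
Let r_odd t : r t.*2.+1 = (- y * w M) * (t == s + M.-1)%N%:R.
Proof.
rewrite rE /weyl interleave_odd (jacobi_interleave_odd b ha_odd ha_even).
have [ts|st] := ltnP t s.
  have x0 : x t.+1 = 0.
    have [->|ts'] := eqVneq t.+1 s.
      by have := x_in M0; rewrite addn0 w0 mulr0.
    by apply: x_lt; rewrite ltn_neqAle ts' ts.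
  by rewrite x0 (x_lt ts) (z_lt ts) ltn_eqF ?ltn_addr//=; ring.
have [j tj] : exists j, t = (s + j)%N by exists (t - s)%N; rewrite subnKC.
rewrite {st}tj eqn_add2l -addnS.
have [jM|Mj] := ltnP j M; last first.
  by rewrite x_ge ?leq_add2l// z_ge ?leq_add2l// x_ge ?leq_add2l ?(leqW Mj)// gtn_eqF ?prednK// /=; ring.
rewrite x_in// z_in// (model_b_blockS hb n1); last by rewrite -/s; move: jM; rewrite /M; lia.
have [jM'|] := ltnP j.+1 M.
  have -> : (j == M.-1) = false by apply/eqP; lia.
  by rewrite x_in//=; ring.
move=> Mj; have MjE : M = j.+1 by apply/eqP; rewrite eqn_leq Mj jM.
by rewrite MjE /= eqxx x_ge ?MjE// /=; ring.
Qed.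

Hypothesis c1 : `|c| < 1.

(** Only boundary terms remain, bounded uniformly in n by [osc_upper]: 9 from the left end and 10 +
    10 + 16 = 36 times that bound from the right end. *)
Lemma weyl_residual : y ^+ 2 <= 16 ->
  dot (jacobi a b weyl - (beta R n + y) *: weyl) (jacobi a b weyl - (beta R n + y) *: weyl)
    <= 9 + 36 * (1 - `|c|)^-1.
Proof.
move=> y16; rewrite -/r (@dot_fin _ _ _ (s + M).+1.*2); last first.
  move=> k sk; rewrite -(odd_double_half k).
  have kh : ((s + M).+1 <= k./2)%N by rewrite -leq_double; lia.
  case: (odd k); rewrite ?add1n ?add0n ?r_odd ?r_even.
    by rewrite gtn_eqF ?mulr0//; lia.
  by rewrite !gtn_eqF ?mulr0 ?addr0//; lia.
rewrite sum_double.
pose al := 3 * w M.-1 + w M; pose ga := - y * w M.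
have b1 : w M ^+ 2 <= (1 - `|c|)^-1 := osc_upper c1 M.
have b2 : w M.-1 ^+ 2 <= (1 - `|c|)^-1 := osc_upper c1 M.-1.
apply: (@le_trans _ _ (9 + al ^+ 2 + ga ^+ 2)).
  rewrite -[X in X + _ + _](@sum_indicator _ 9 s (s + M).+1) ?ltnS ?leq_addr//.
  rewrite -[X in _ + X + _](@sum_indicator _ (al ^+ 2) (s + M) (s + M).+1)//.
  rewrite -[X in _ + _ + X](@sum_indicator _ (ga ^+ 2) (s + M.-1) (s + M).+1); last by lia.
  rewrite -!big_split/=; apply: ler_sum => t _; rewrite r_even r_odd -/al -/ga.
  rewrite -!expr2; apply: lerD; last first.
    by case: (t == _); rewrite ?mulr1// !mulr0 expr0n.
  have [->|ts] := eqVneq t s.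
    by rewrite sM_neq ?mulr0 ?addr0 ?mulr1//; lra.
  by case: (t == _); rewrite !mulr0 !add0r ?mulr1 ?mulr0 ?expr0n.
have g1 : ga ^+ 2 <= 16 * w M ^+ 2.
  by rewrite /ga exprMn sqrrN ler_wpM2r// sqr_ge0.
have a1 : al ^+ 2 <= 10 * w M.-1 ^+ 2 + 10 * w M ^+ 2.
  rewrite -subr_ge0 /al (_ : _ - _ = (w M.-1 - 3 * w M) ^+ 2) ?sqr_ge0//; ring.
lra.
Qed.

(** Each of the 2n cells contributes at least 1/8, so the norm outgrows the bounded residual. *)
Lemma weyl_norm : 4 <= y ^+ 2 -> n%:R / 4 <= dot weyl weyl.
Proof.
move=> y4; rewrite (dot_fin _ weyl_supp) sum_double (big_cat_nat (leq0n s) (leq_addr M s))/=.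
have sq k : 0 <= weyl k * weyl k by rewrite -expr2 sqr_ge0.
apply: (@le_trans _ _ (\sum_(s <= t < s + M) 8^-1)).
  by rewrite sumr_const_nat addKn /M mulnC mulrnA -mulr_natl -[_ *+ 2]mulr_natr; lra.
rewrite -[leLHS]add0r lerD//; first by rewrite sumr_ge0// => t _; rewrite addr_ge0.
rewrite !big_nat; apply: ler_sum => t /andP[st tM].
rewrite /weyl interleave_even interleave_odd /x /z st tM/=.
have := osc_lower c1 (t - s); rewrite -/w.
move: (w _) (w _) => q p pq.
have h1 : 4 * p ^+ 2 <= y ^+ 2 * p ^+ 2 by rewrite ler_wpM2r// sqr_ge0.
(* Uses 4 p^2 + (3 p + q)^2 - (p^2 + q^2) / 4 = 3/4 ((q + 4 p)^2 + p^2), together with p^2 + q^2 >=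
   1/2. *)
have h2 := sqr_ge0 p; have h3 := sqr_ge0 (q + 4 * p).
have -> : y * p * (y * p) = y ^+ 2 * p ^+ 2 by ring.
move: (y ^+ 2 * p ^+ 2) h1 => Y h1; lra.
Qed.

End Weyl.

(** * The support of the spectral measure *)

Section SupportOfModel.
Variables (R : realType) (a b : nat -> R).
Hypothesis ha_odd : forall n, (1 <= n)%N -> a (2 * n - 1)%N = 3.
Hypothesis ha_even : forall n, (1 <= n)%N -> a (2 * n)%N = 1.
Hypothesis hb1 : b 1%N = beta R 1.
Hypothesis hb : forall n k, (1 <= n)%N -> (2 * n ^ 2 <= k < 2 * n.+1 ^ 2)%N ->
  b k = beta R n.
Variable E : set (measurableTypeR R) -> (nat -> R) -> (nat -> R).
Hypothesis E_res : spectral_resolution (jacobi a b) E.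
Variable mu : probability (measurableTypeR R) R.
Hypothesis muE : forall A, measurable A ->
  mu A = (dot (@delta1 R) (E A (@delta1 R)))%:E.

Let T_ell2 := model_ell2 ha_odd ha_even hb1 hb.
Let T_lin := jacobi_linear a b.
Let T_sym := model_sym ha_odd ha_even hb1 hb.
Let T_bound := model_bound ha_odd ha_even hb1 hb.
Let a0 := model_a_neq0 ha_odd ha_even.

Lemma mu_vanish A : measurable A -> E A (@delta1 R) = 0 -> mu A = 0%E.
Proof. by move=> mA EA; rewrite muE// EA dot0r. Qed.

Lemma mu_gap (h : R) : 0 <= h -> h < 1 -> mu `]- h, h[%classic = 0%E.
Proof.
move=> h0 h1; apply: mu_vanish; first exact: measurable_itv.
have gap u (lu : ell2 u) := model_gap ha_odd ha_even hb1 hb lu.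
have iso (u : nat -> R) : ell2 u -> dot (swap u) (swap u) = dot u u.
  by move=> lu; exact: dot_swap.
have H := gap_vanish T_ell2 T_lin T_sym E_res (@ell2_swap R) iso gap h1 h0 (@ell2_delta1 R).
exact: H.
Qed.

Lemma mu_out (A : set (measurableTypeR R)) M : measurable A -> 5 < M ->
  (forall x, A x -> M <= x) \/ (forall x, A x -> x <= - M) -> mu A = 0%E.
Proof.
move=> mA M5 AM; apply: mu_vanish => //.
exact: (proj_out E_res T_bound mA (@ell2_delta1 R) M5 AM).
Qed.

(** Cyclicity of [delta1]: |E A e_n|^2 is the integral over A of the square of the n-th polynomial,
    so the projection of a null set kills every finitely supported vector. *)
Lemma proj_fin_vanish A v N : measurable A -> mu A = 0%E ->
  (forall i, (N <= i)%N -> v i = 0) -> E A v = 0.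
Proof.
move=> mA muA vN; rewrite (fin_sum_basis vN).
have Eb n : E A (basis_vec R n) = 0.
  have lb := @ell2_basis R n.
  apply: dot_eq0; first exact: (proj_ell2 E_res mA lb).
  rewrite -(dot_proj E_res mA lb).
  rewrite (dot_basis_proj (ler0n R 3) (model_a_le3 ha_odd ha_even) (model_b_le3 hb1 hb) E_res T_bound muE a0 _ _ mA).
  rewrite /Rintegral (null_set_integral mA)//.
  exact: measurable_int (integrable_horner E_res T_bound (@ell2_delta1 R) muE _ mA).
suff: ell2 (\sum_(0 <= n < N) v n *: basis_vec R n) /\
    E A (\sum_(0 <= n < N) v n *: basis_vec R n) = 0 by case.
apply: (big_ind (fun w => ell2 w /\ E A w = 0)).
- by split; [exact: ell2_0|exact: (proj0 E_res)].
- move=> w1 w2 [l1 E1] [l2 E2]; split; first exact: ell2D.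
  by rewrite (projD E_res mA l1 l2) E1 E2 addr0.
- move=> n _; have lb := @ell2_basis R n; split; first exact: ell2Z.
  by rewrite (projZ E_res _ mA lb) Eb scaler0.
Qed.

(** If the interval were null, its projection would kill the Weyl vector, and [resolvent_bound]
    would force a residual larger than the one computed. *)
Lemma mu_near_neq0 (y h : R) n : 4 < y ^+ 2 < 16 -> 0 < h -> (1 <= n)%N ->
  9 + 36 * (1 - `|(y ^+ 2 - 10) / 6|)^-1 < h ^+ 2 * (n%:R / 4) ->
  mu `](beta R n + y) - h, (beta R n + y) + h[%classic != 0%E.
Proof.
move=> /andP[y4 y16] h0 n1 big; apply/eqP => mu0.
pose c := (y ^+ 2 - 10) / 6.
have c1 : `|c| < 1.
  by rewrite ltr_norml /c ltr_pdivlMr// ltr_pdivrMr//; apply/andP; split; lra.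
have yc : y ^+ 2 = 10 + 6 * c by rewrite /c; field.
have lv : ell2 (weyl y c n) by exact: ell2_fin (@weyl_supp R y c n).
have Ev : E `](beta R n + y) - h, (beta R n + y) + h[%classic (weyl y c n) = 0.
  by apply: proj_fin_vanish mu0 (@weyl_supp R y c n); exact: measurable_itv.
have := resolvent_bound T_ell2 T_lin T_sym E_res lv (ltW h0) Ev.
have res := weyl_residual ha_odd ha_even hb n1 yc c1 (ltW y16).
have nrm := weyl_norm n c1 (ltW y4).
move=> /le_trans/(_ res); rewrite leNgt => /negP; apply; apply: lt_le_trans big _.
by rewrite ler_wpM2l// sqr_ge0.
Qed.

(** Here sg = 3 or -3 is the centre of a band. The offset t is shared: about half of it goes into
    the energy y, the other half into beta_n. *)
Lemma supp_bands (sg t : R) : sg ^+ 2 = 9 -> `|t| <= 2 -> supp mu (sg + t).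
Proof.
move=> sg9; rewrite ler_norml => /andP[t1 t2] U oU Ut.
have /nbhs_ballP[e /= e0 eU] : nbhs (sg + t) U by exact: open_nbhs_nbhs.
(* Shrinking t/2 by the factor 1 - eta puts tau strictly inside (-1, 1), so that 2 < |y| < 4. The
   errors e/2 from h, e/4 from beta_n and e/8 from eta add up to less than e. *)
pose eta := Num.min 2^-1 (e / 8).
have eta0 : 0 < eta by rewrite /eta lt_min invr_gt0 ltr0n/= divr_gt0.
have eta1 : eta <= 2^-1 by rewrite /eta ge_min lexx.
have eta2 : eta <= e / 8 by rewrite /eta ge_min lexx orbT.
pose tau := t / 2 * (1 - eta).
have [tau1 tau2] : -1 < tau /\ tau < 1 by rewrite /tau; split; nra.
pose y := sg + tau.
have y2 : 4 < y ^+ 2 < 16.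
  have [sgE|sgE] : sg = 3 \/ sg = - 3.
    have : (sg - 3) * (sg + 3) == 0 by apply/eqP; lra.
    by rewrite mulf_eq0 => /orP[] /eqP h; [left|right]; lra.
  - by rewrite /y sgE; apply/andP; split; nra.
  - by rewrite /y sgE; apply/andP; split; nra.
pose C := 9 + 36 * (1 - `|(y ^+ 2 - 10) / 6|)^-1.
pose h := e / 2; have h0 : 0 < h by rewrite divr_gt0.
(* C and h are fixed before n, so every n >= m satisfies the inequality of [mu_near_neq0]. *)
pose m := (Num.truncn (C * 4 / h ^+ 2)).+1.
have lr : Num.max (-1) (t / 2 - e / 4) < Num.min 1 (t / 2 + e / 4).
  by rewrite gt_max !lt_min; apply/andP; split; apply/andP; split; lra.
have [||n mn /andP[ln nr]] := @beta_dense R _ _ m _ lr.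
- by rewrite le_max lexx.
- by rewrite ge_min lexx.
move: ln nr; rewrite gt_max lt_min => /andP[_ ln] /andP[_ nr].
have n1 : (1 <= n)%N by apply: leq_trans mn.
have big : C < h ^+ 2 * (n%:R / 4).
  have h2 : 0 < h ^+ 2 by rewrite exprn_gt0.
  have : C * 4 / h ^+ 2 < n%:R.
    by apply: lt_le_trans (truncnS_gt _) _; rewrite ler_nat.
  by rewrite ltr_pdivrMr//; lra.
set B := `](beta R n + y) - h, (beta R n + y) + h[%classic.
have muB : (0 < mu B)%E by rewrite lt0e measure_ge0 andbT; exact: mu_near_neq0.
apply: lt_le_trans muB _.
apply: le_measure; rewrite ?inE.
- exact: measurable_itv.
- exact: open_measurable.
move=> q; rewrite /B/= in_itv/= => /andP[q1 q2]; apply: eU.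
rewrite /ball/= ltr_norml.
have tb1 : - eta <= t / 2 - tau by rewrite /tau; nra.
have tb2 : t / 2 - tau <= eta by rewrite /tau; nra.
move: q1 q2; rewrite /y /h => q1 q2; apply/andP; split; lra.
Qed.

(** Off the bands x has a null neighbourhood: a ray starting halfway between x and the endpoint 5 or
    -5, or ]-h, h[ with h halfway between |x| and 1. *)
Lemma supp_model : supp mu = `[-5, -1] `|` `[1, 5].
Proof.
have contra_out (x : R) (U : set R) : open U -> U x -> mu U = 0%E -> ~ supp mu x.
  by move=> oU Ux U0 /(_ U oU Ux); rewrite U0 ltxx.
apply/seteqP; split => x; last first.
  case=> /=; rewrite in_itv/= => /andP[x1 x2].
    rewrite (_ : x = -3 + (x + 3)); last by ring.
    by apply: supp_bands; [ring|rewrite ler_norml; apply/andP; split; lra].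
  rewrite (_ : x = 3 + (x - 3)); last by ring.
  by apply: supp_bands; [ring|rewrite ler_norml; apply/andP; split; lra].
move=> sx; rewrite /= !in_itv/=.
have [x5|x5] := ltP 5 x.
  exfalso; apply: (contra_out x `]((5 + x) / 2), +oo[%classic) sx.
  - exact: interval_open.
  - by rewrite /= in_itv/= andbT; lra.
  - apply: (mu_out (M := (5 + x) / 2)); [exact: measurable_itv|lra|left => z /=].
    by rewrite in_itv/= andbT => /ltW.
have [x5'|x5'] := ltP x (- 5).
  exfalso; apply: (contra_out x `]-oo, ((x - 5) / 2)[%classic) sx.
  - exact: interval_open.
  - by rewrite /= in_itv/=; lra.
  - apply: (mu_out (M := (5 - x) / 2)); [exact: measurable_itv|lra|right => z /=].
    by rewrite in_itv/= => zx; lra.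
have [x1|x1] := ltP `|x| 1; last first.
  by move: x1; rewrite ler_normr => /orP[x1|x1]; [right|left]; apply/andP; split; lra.
exfalso; pose h := (1 + `|x|) / 2; have x0 := normr_ge0 x.
apply: (contra_out x `]- h, h[%classic) sx.
- exact: interval_open.
- have := ler_norm x; have := ler_norm (- x); rewrite normrN /= in_itv/= /h => ? ?.
  by apply/andP; split; lra.
- by apply: mu_gap; rewrite /h; lra.
Qed.

End SupportOfModel.

(** * Support, zeros near beta_n and density of the zeros *)

Theorem mainTheorem3 (R : realType) (a b : nat -> R)
    (mu : probability (measurableTypeR R) R) (p : nat -> {poly R})
    (ha_odd : forall n, (1 <= n)%N -> a (2 * n - 1)%N = 3)
    (ha_even : forall n, (1 <= n)%N -> a (2 * n)%N = 1)
    (hb1 : b 1%N = beta R 1)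
    (hb : forall n k, (1 <= n)%N -> (2 * n ^ 2 <= k < 2 * n.+1 ^ 2)%N ->
       b k = beta R n)
    (hmu : spectral_measure (jacobi a b) (@delta1 R) mu)
    (hp : orthonormal_polynomials mu p) :
  [/\ supp mu = `[-5, -1] `|` `[1, 5],
      forall n, (1 <= n)%N ->
        exists2 x : R, `|x - beta R n| <= 2 / 3 ^+ (2 * n)
                     & root (p (2 * n.+1 ^ 2 - 1)%N) x
    & `[-1, 1] `<=`
        closure [set x : R | -1 < x < 1 /\ exists n, root (p n) x] ].
Proof.
have [E E_res muE] := hmu.
have roots n : (1 <= n)%N -> exists2 x : R, `|x - beta R n| <= (3 ^+ (2 * n))^-1
    & root (p (2 * n.+1 ^ 2 - 1)%N) x.
  move=> n1; have [x xb rx] := root_near_beta ha_odd ha_even hb n1.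
  exists x => //.
  (* [p] differs from the recurrence polynomials by nonzero factors, so the roots are the same. *)
  have [c c0 ->] := orthonormal_polynomials_scale (ler0n R 3) (model_a_le3 ha_odd ha_even)
    (model_b_le3 hb1 hb) E_res (model_bound ha_odd ha_even hb1 hb) muE (model_a_neq0 ha_odd ha_even)
    (2 * n.+1 ^ 2 - 1) hp.
  by rewrite rootZ.
split.
- exact: (supp_model ha_odd ha_even hb1 hb E_res muE).
- move=> n n1; have [x xb rx] := roots n n1; exists x => //; apply: le_trans xb _.
  by rewrite ler_peMl ?invr_ge0 ?exprn_ge0//; lra.
move=> x /=; rewrite in_itv/= => /andP[x1 x2] U /nbhs_ballP[e /= e0 eU].
(* beta_n will be within 2d of x and more than d away from -1 and 1; a zero within d of it then lies
   in (-1, 1) and within 3d < e of x. *)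
pose d := Num.min (e / 4) 4^-1.
have d0 : 0 < d by rewrite /d lt_min divr_gt0//= invr_gt0.
have d1 : d <= e / 4 by rewrite /d ge_min lexx.
have d2 : d <= 4^-1 by rewrite /d ge_min lexx orbT.
pose l := Num.max (-1 + d) (x - 2 * d); pose r := Num.min (1 - d) (x + 2 * d).
have lr : l < r.
  by rewrite /l /r gt_max !lt_min; apply/andP; split; apply/andP; split; lra.
have l1 : -1 <= l by rewrite /l le_max; apply/orP; left; lra.
have r1 : r <= 1 by rewrite /r ge_min; apply/orP; left; lra.
(* From n >= m > 1/d and n < 3^(2n) follows 3^(-2n) < d. *)
pose m := (Num.truncn d^-1).+1.
have [n mn /andP[]] := beta_dense m l1 lr r1.
rewrite /l /r gt_max lt_min => /andP[ln1 ln2] /andP[rn1 rn2].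
have n1 : (1 <= n)%N by apply: leq_trans mn.
have [z zb rz] := roots n n1.
have nd : (3 ^+ (2 * n))^-1 < d :> R.
  rewrite invf_plt ?posrE ?exprn_gt0//.
  have n3 : (n < 3 ^ (2 * n))%N.
    by apply: (@leq_ltn_trans (2 * n)); [exact: leq_pmull|exact: ltn_expl].
  apply: lt_le_trans (truncnS_gt _) _; rewrite -/m -natrX ler_nat.
  exact: leq_trans mn (ltnW n3).
move: (le_lt_trans zb nd); rewrite ltr_norml => /andP[z1 z2].
exists z; split; first by split; [apply/andP; split; lra|exists (2 * n.+1 ^ 2 - 1)%N].
by apply: eU; rewrite /ball/= ltr_norml; apply/andP; split; lra.
Qed.
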